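(* Let $D_2$ be a non-abelian finite group admitting an abelian subgroup $A$ of index $2$, with the presentation $$D_2=\langle A,b\mid b^2=y,\ bab^{-1}=f(a)\ (a\in A)\rangle ,$$ where $A$ is a finite abelian group of order $n\ge 3$, $f\in\mathrm{Aut}(A)$ is of order $2$, and $y\in A$ satisfies $f(y)=y$. Write $A\cong\langle a_1\rangle\times\cdots\times\langle a_{\lambda+\mu}\rangle$ with $\langle a_i\rangle\cong C_{p_i^{e_i}}$, where the $p_i$ are primes, $\lambda+\mu\ne 0$, and $p_i=2$ if and only if $1\le i\le\lambda$. Since $f\in\mathrm{Aut}(A)$, there are integers $s_1,\ldots,s_{\lambda+\mu}$ such that $f((a_1,\ldots,a_{\lambda+\mu}))=(a_1^{s_1},\ldots,a_{\lambda+\mu}^{s_{\lambda+\mu}})$, i.e. $f$ acts on the $i$-th cyclic factor by $x\mapsto x^{s_i}$; put $d_i=\gcd(s_i-1,p_i^{e_i})$ and $n_i=p_i^{e_i}/d_i$. Let $I_{r,1}=I_{r,2}=(\ell_{r1},\ldots,\ell_{r(\lambda+\mu)})$, $1\le r\le d$, be the tuples indexing the one-dimensional irreducible representations of $D_2$, and $J_u=(k_{u1},\ldots,k_{u(\lambda+\mu)})$, $1\le u\le\frac{n-d}2$, the tuples indexing its inequivalent two-dimensional irreducible representations (as described in the context). If $M_m$ denotes the algebra of $m\times m$ complex matrices, then $$\mathcal T(D_2)\cong\left(\bigoplus_{r=1}^{d}M_{d_{I_{r,1}}}\right)\oplus\left(\bigoplus_{r=1}^{d}M_{d_{I_{r,2}}}\right)\oplus\left(\bigoplus_{u=1}^{\frac{n-d}{2}}M_{d_{J_u}}\right),$$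 where $d=\prod_{i=1}^{\lambda+\mu}d_i$, $n=|A|$, and $$d_{I_{r,1}}=\begin{cases}\frac n2+\frac{3d}2,&\text{if } d_i\mid\ell_{ri}\text{ for all }1\le i\le\lambda+\mu,\\ \frac d2,&\text{if } d_i\nmid\ell_{ri}\text{ for some } 1\le i\le\lambda+\mu\text{ and } d_i\mid n_i\ell_{ri}\text{ for all }1\le i\le\lambda+\mu,\\ 0,&\text{otherwise,}\end{cases}$$ $$d_{I_{r,2}}=\begin{cases}\frac n2-\frac{d}2,&\text{if } d_i\mid\ell_{ri}\text{ for all }1\le i\le\lambda+\mu,\\ \frac d2,&\text{if } d_i\nmid\ell_{ri}\text{ for some } 1\le i\le\lambda+\mu\text{ and } d_i\mid n_i\ell_{ri}\text{ for all }1\le i\le\lambda+\mu,\\ 0,&\text{otherwise,}\end{cases}$$ $$d_{J_u}=\begin{cases}d,&\text{if } d_i\mid k_{ui}\text{ for all }1\le i\le\lambda+\mu,\\0,&\text{otherwise.}\end{cases}$$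
   Context: $M_0$ is the zero algebra. In the presentation of $D_2$ it is understood that the relations of $A$ hold; $D_2$ has order $2n$, and each of its elements is uniquely of the form $a$ or $ab$ with $a\in A$. Terwilliger algebra: for a finite group $G$ with identity $e$ and conjugacy classes $\mathbf{Cl}_0=\{e\},\mathbf{Cl}_1,\ldots,\mathbf{Cl}_\ell$, let $N_i$ be the $|G|\times|G|$ complex $0/1$-matrix (rows and columns indexed by $G$) with $(N_i)_{x,y}=1$ iff $yx^{-1}\in\mathbf{Cl}_i$, and let $E_i^*$ be the diagonal matrix with $(u,u)$ entry $1$ if $u\in\mathbf{Cl}_i$ and $0$ otherwise. $\mathcal T(G)$ is the subalgebra of $M_{|G|}(\mathbb C)$ generated by all $N_i$ and all $E_i^*$, $0\le i\le\ell$. Indexing of the irreducible representations of $D_2$: let $\zeta_m$ be a primitive $m$-th root of unity, let $B=\{f(a)a^{-1}\mid a\in A\}$, and write $a=(a_1^{t_1},\ldots,a_{\lambda+\mu}^{t_{\lambda+\mu}})\in A$ and $y=(a_1^{v_1},\ldots,a_{\lambda+\mu}^{v_{\lambda+\mu}})$. The tuples $I_r:=I_{r,1}=I_{r,2}$, $1\le r\le d$, run over all integer tuples $(\ell_1,\ldots,\ell_{\lambda+\mu})$ with $0\le\ell_i\le d_i-1$; each gives two one-dimensional representations of $D_2$, both sending $a\mapsto\prod_i\zeta_{d_i}^{\ell_it_i}$, with $b\mapsto\prod_i\zeta_{d_i}^{\ell_iv_i/2}$ for the index $I_{r,1}$ and $b\mapsto-\prod_i\zeta_{d_i}^{\ell_iv_i/2}$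 for the index $I_{r,2}$. For an integer tuple $J=(k_1,\ldots,k_{\lambda+\mu})$ with $0\le k_i\le p_i^{e_i}-1$ let $\sigma_J(a)=\prod_i\zeta_{p_i^{e_i}}^{k_it_i}$; when $B\not\subseteq\ker\sigma_J$, the representation $a\mapsto\mathrm{diag}(\sigma_J(a),\sigma_J(f(a)))$, $b\mapsto\begin{pmatrix}0&\sigma_J(y)\\1&0\end{pmatrix}$ is a two-dimensional irreducible representation of $D_2$. Up to equivalence there are exactly $\frac{n-d}2$ of these, and $J_1,\ldots,J_{(n-d)/2}$ are tuples $J$, one for each equivalence class. In particular $J_u\neq(0,\ldots,0)$.
   Formalization: The integers s_i do not exist for every f ∈ Aut(A) (e.g. the group of order 8 with A = C_2×C_2 and f swapping two generators); that f acts on each chosen cyclic factor by x ↦ x^{s_i} is taken as a hypothesis. *)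

(* Defs.v *)
From HB Require Import structures.
From mathcomp Require Import all_boot all_order all_algebra all_fingroup.
From mathcomp Require Import all_solvable all_field all_character.
From mathcomp Require Import reals.
From mathcomp.real_closed Require Import complex.
Set Implicit Arguments.
Unset Strict Implicit.
Unset Printing Implicit Defensive.
Import GRing.Theory.
Local Open Scope ring_scope.

(* Matrices indexed by a finite group G are matrices of size #|G|; the index
   i : 'I_#|G| stands for the group element enum_val i. *)

Section Terwilliger.
Variables (C : fieldType) (gT : finGroupType) (G : {group gT}).

Definition class_mx (K : {set gT}) : 'M[C]_#|G| :=
  \matrix_(i, j) ((enum_val j * (enum_val i)^-1)%g \in K)%:R.

Definition class_idem (K : {set gT}) : 'M[C]_#|G| :=
  \matrix_(i, j) ((i == j) && (enum_val i \in K))%:R.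

Inductive gen_subalgebra (n : nat) (S : 'M[C]_n -> Prop) : 'M[C]_n -> Prop :=
| gen_subalgebra_gen X : S X -> gen_subalgebra S X
| gen_subalgebra1 : gen_subalgebra S 1%:M
| gen_subalgebraP c X Y :
    gen_subalgebra S X -> gen_subalgebra S Y -> gen_subalgebra S (c *: X + Y)
| gen_subalgebraM X Y :
    gen_subalgebra S X -> gen_subalgebra S Y -> gen_subalgebra S (X *m Y).

Definition terwilliger : 'M[C]_#|G| -> Prop :=
  gen_subalgebra (fun X => exists2 K : {set gT},
    K \in classes G & X = class_mx K \/ X = class_idem K).

End Terwilliger.

Arguments terwilliger C {gT} G.

(* The subalgebra T of 'M_n is isomorphic, as a unital algebra, to the direct
   sum of the 'M_(m i), i : I, whose elements are the families
   Y : forall i, 'M_(m i) with componentwise operations; phi i is the i-th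
   component of the isomorphism.  Note that 'M_0 is the zero algebra. *)
Definition isog_matrix_sum (C : fieldType) (n : nat) (T : 'M[C]_n -> Prop)
    (I : finType) (m : I -> nat) : Prop :=
  exists phi : forall i : I, 'M[C]_n -> 'M[C]_(m i),
  [/\ forall i c X Y, T X -> T Y -> phi i (c *: X + Y) = c *: phi i X + phi i Y,
      forall i X Y, T X -> T Y -> phi i (X *m Y) = phi i X *m phi i Y,
      forall i, phi i 1%:M = 1%:M,
      forall X Y, T X -> T Y -> (forall i, phi i X = phi i Y) -> X = Y
    & forall Y : (forall i, 'M[C]_(m i)), exists2 X, T X & forall i, phi i X = Y i].

Definition zexpg (gT : finGroupType) (x : gT) (s : int) : gT :=
  match s with
  | Posz n => (x ^+ n)%g
  | Negz n => (x ^- n.+1)%g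
  end.

(* G = < A, b | relations of A, b ^ 2 = y, b a b^-1 = f a (a in A) >.  The last
   clause is von Dyck's universal property, among all groups: every solution of
   the relations in a group H extends to a homomorphism on G. *)
Definition presents_ext2 (gT : finGroupType) (G A : {group gT}) (f : {perm gT})
    (b y : gT) : Prop :=
  [/\ G :=: <<b |: A>>%g,
      (b ^+ 2 = y)%g,
      {in A, forall c, b * c * b^-1 = f c}%g
    & forall (H : groupType) (phi : gT -> H) (h : H),
        {in A &, {morph phi : x z / (x * z)%g >-> (x * z)%g}} ->
        (h ^+ 2 = phi y)%g ->
        {in A, forall c, h * phi c * h^-1 = phi (f c)}%g ->
        exists psi : gT -> H,
          [/\ {in G &, {morph psi : x z / (x * z)%g >-> (x * z)%g}},
              {in A, psi =1 phi} & psi b = h]].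

Section TwoDimensional.
Variables (C : fieldType) (zeta : nat -> C) (gT : finGroupType).
Variables (G A : {group gT}) (f : {perm gT}) (b y : gT).
Variables (k : nat) (a : 'I_k -> gT) (q : 'I_k -> nat).
Implicit Type J : 'I_k -> nat.

(* Exponents t with x = a_1 ^ t_1 ... a_k ^ t_k; the choice is immaterial below,
   since each t_i is determined modulo q i, the order of a i. *)
Definition coords (x : gT) : 'I_k -> nat :=
  if [pick t : {ffun 'I_k -> 'I_#|gT|} | x == (\prod_i a i ^+ t i)%g] is Some t
  then fun i => t i else fun=> 0%N.

Definition sigma J (x : gT) : C := \prod_i zeta (q i) ^+ (J i * coords x i).

Definition rho2A J (x : gT) : 'M[C]_(1 + 1) :=
  block_mx (sigma J x)%:M 0 0 (sigma J (f x))%:M.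

Definition rho2b J : 'M[C]_(1 + 1) := block_mx 0 (sigma J y)%:M 1%:M 0.

(* The two-dimensional representation attached to J; an element of G outside A
   is x * b for a unique x in A. *)
Definition rho2 J (g : gT) : 'M[C]_(1 + 1) :=
  if g \in A then rho2A J g else rho2A J (g * b^-1)%g *m rho2b J.

(* B = {f(c) c^-1 | c in A} is not contained in the kernel of sigma J, which is
   the condition for rho2 J to be irreducible. *)
Definition admissible J : Prop :=
  (forall i, (J i < q i)%N) /\
  exists2 x, x \in [set (f c * c^-1)%g | c in A] & sigma J x != 1.

Definition rho2_equiv J J' : Prop :=
  exists2 P : 'M[C]_(1 + 1), P \in unitmx &
    {in G, forall g, rho2 J g *m P = P *m rho2 J' g}.

Definition indexes_irr2 (N : nat) (J : 'I_N -> 'I_k -> nat) : Prop :=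
  [/\ forall u, admissible (J u),
      forall u w, rho2_equiv (J u) (J w) -> u = w
    & forall J', admissible J' -> exists u, rho2_equiv J' (J u)].

End TwoDimensional.

(* A tuple l with l_i < d_i stands for the linear character of A sending
   prod_i a_i ^ t_i to prod_i zeta_(d_i) ^ (l_i t_i); these are the linear
   characters of A that extend to G, each in exactly two ways. *)
Definition indexes_irr1 (k : nat) (d : 'I_k -> nat) (N : nat)
    (I : 'I_N -> 'I_k -> nat) : Prop :=
  (forall r i, (I r i < d i)%N) /\
  (forall l : 'I_k -> nat, (forall i, (l i < d i)%N) -> exists! r, I r =1 l).

Definition fix_ord (k : nat) (q : 'I_k -> nat) (s : 'I_k -> int) (i : 'I_k) : nat :=
  gcdn `|s i - 1| (q i).

(* The halves below are exact in the cases where they are used: n - d is even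
   because f has d fixed points in A, and when the middle case occurs d is even. *)
Section Dimensions.
Variables (k : nat) (q d : 'I_k -> nat) (n D : nat).

Definition middle_case (l : 'I_k -> nat) : bool :=
  [exists i, ~~ (d i %| l i)%N] && [forall i, (d i %| q i %/ d i * l i)%N].

Definition dim_I1 (l : 'I_k -> nat) : nat :=
  if [forall i, (d i %| l i)%N] then ((n + 3 * D)./2)%N
  else if middle_case l then (D./2)%N else 0%N.

Definition dim_I2 (l : 'I_k -> nat) : nat :=
  if [forall i, (d i %| l i)%N] then ((n - D)./2)%N
  else if middle_case l then (D./2)%N else 0%N.

Definition dim_J (l : 'I_k -> nat) : nat :=
  if [forall i, (d i %| l i)%N] then D else 0%N.

Definition block_dim (N1 N2 : nat) (I : 'I_N1 -> 'I_k -> nat)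
    (J : 'I_N2 -> 'I_k -> nat) (x : 'I_N1 + 'I_N1 + 'I_N2) : nat :=
  match x with
  | inl (inl r) => dim_I1 (I r)
  | inl (inr r) => dim_I2 (I r)
  | inr u => dim_J (J u)
  end.

End Dimensions.

(* Main.v *)
Require Import Defs.
From HB Require Import structures.
From mathcomp Require Import all_boot all_order all_algebra all_fingroup.
From mathcomp Require Import all_solvable all_field all_character.
From mathcomp Require Import ring.
From mathcomp Require Import reals.
From mathcomp.real_closed Require Import complex.
Set Implicit Arguments.
Unset Strict Implicit.
Unset Printing Implicit Defensive.
Import GRing.Theory Num.Theory.
Local Open Scope ring_scope.

(* The Terwilliger algebra always lies in the commutant of the conjugation
   permutation representation of G on C^G.  Since A is abelian of index 2, the
   classes of x, z x^-1 and z determine the G-orbit of (x, z), so the products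
   E*_i N_j E*_k span that commutant, and the theorem becomes a computation of
   multiplicities in the conjugation representation.  For a character sigma of
   A, the sigma-eigenspace of A has dimension
   n [sigma = 1] + d [sigma = 1 on A^f].  If sigma is f-invariant, b acts on it
   with trace 2 d [sigma = 1] and eigenvalues the square roots of sigma(y), and
   the two eigenspaces of b carry the linear characters extending sigma; if not,
   its dimension is the multiplicity of the representation induced by sigma. *)

(** * Commutants as sums of matrix algebras *)

(** The commutant is decomposed without a classification of the irreducible representations of G. It
    is enough to have one idempotent for each block, such that distinct ones annihilate each other
    even with an element of G in between, each compresses G to scalars, and suitable multiples of
    the sums of their G-conjugates add up to 1. The size of a block is then a rank, hence a trace,
    and a representation that does not occur simply has rank 0. The traces come from centralizers:
    for x in A, |C_G(x)| is n, plus another n if f fixes x, while it is 2d on the whole coset A b.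
    The final sum is 1 because the f-invariant tuples, the [J u] and the conjugates of the [J u] run
    bijectively over all characters of A. The numbers are explicit because f multiplies exponents
    and character tuples by the same s i, so fixed elements and invariant characters obey the same
    divisibility. *)

Lemma idempotent_factor (C : fieldType) (n m : nat) (E : 'M[C]_n) :
  E *m E = E -> \rank E = m ->
  exists PQ : 'M[C]_(n, m) * 'M[C]_(m, n),
    (PQ.1 *m PQ.2 == E) && (PQ.2 *m PQ.1 == 1%:M).
Proof.
move=> EE <-; exists (col_base E, row_base E) => /=.
rewrite mulmx_base eqxx /=; apply/eqP.
(* Multiplied by [c] on the left and [r] on the right, both sides become E, as c (r c) r = E E = E;
   full rank allows cancelling. *)
apply: (row_full_inj (col_base_full E)); apply: (row_free_inj (row_base_free E)).
set c := col_base E; set r := row_base E.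
have cr : c *m r = E by apply: mulmx_base.
suff: c *m (r *m c) *m r = c *m 1%:M *m r by [].
clearbody c r.
by rewrite mulmx1 !mulmxA cr -mulmxA cr EE.
Qed.

Lemma mxtrace_idempotent (C : fieldType) (n : nat) (E : 'M[C]_n) :
  E *m E = E -> \tr E = (\rank E)%:R.
Proof.
move=> EE; have [[P Q] /= /andP[/eqP PQ /eqP QP]] := idempotent_factor EE erefl.
by rewrite -PQ mxtrace_mulC QP mxtrace1 PQ.
Qed.

Lemma eq_isog_matrix_sum (C : fieldType) (n : nat) (T T' : 'M[C]_n -> Prop)
    (I : finType) (m : I -> nat) :
  (forall X, T X <-> T' X) -> isog_matrix_sum T' m -> isog_matrix_sum T m.
Proof.
move=> TT' [phi [lin mul one inj surj]]; exists phi; split=> //.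
- by move=> i c X Y /TT' TX /TT' TY; apply: lin.
- by move=> i X Y /TT' TX /TT' TY; apply: mul.
- by move=> X Y /TT' TX /TT' TY; apply: inj.
by move=> Y; have [X /TT' TX XY] := surj Y; exists X.
Qed.

Definition commutant (C : fieldType) (gT : finGroupType) (G : {group gT})
    (n : nat) (rho : gT -> 'M[C]_n) (X : 'M[C]_n) : Prop :=
  {in G, forall g, X *m rho g = rho g *m X}.

(* The [E i] are primitive idempotents, one for each irreducible constituent;
   the component of [X] is its action on the image of [E i], read through a
   factorisation [E i = P i *m Q i] with [Q i *m P i = 1]. *)
Lemma commutant_isog (C : fieldType) (gT : finGroupType) (G : {group gT})
    (n : nat) (rho : gT -> 'M[C]_n) (I : finType) (m : I -> nat)
    (E : I -> 'M[C]_n) (c : I -> C) :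
  {in G &, forall g h, rho (g * h)%g = rho g *m rho h} ->
  rho 1%g = 1%:M ->
  (forall i X, commutant G rho X -> X *m E i = E i *m X) ->
  (forall i, E i *m E i = E i) ->
  (forall i, \rank (E i) = m i) ->
  (forall i j g, i != j -> g \in G -> E i *m rho g *m E j = 0) ->
  (forall i g, g \in G -> exists l, E i *m rho g *m E i = l *: E i) ->
  \sum_i c i *: (\sum_(g in G) rho g *m E i *m rho g^-1%g) = 1%:M ->
  isog_matrix_sum (commutant G rho) m.
Proof.
move=> rhoM rho1 Ecomm EE rkE E0 Escal sumE.
(* The factorisation is stated with boolean equations so that [sigW] can choose one for every i. *)
pose PQ i := sigW (idempotent_factor (EE i) (rkE i)).
pose P i := (sval (PQ i)).1; pose Q i := (sval (PQ i)).2.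
have PQE i : P i *m Q i = E i by rewrite /P /Q; case: (PQ i) => ? /= /andP[/eqP].
have QPE i : Q i *m P i = 1%:M by rewrite /P /Q; case: (PQ i) => ? /= /andP[_ /eqP].
have QE i : Q i *m E i = Q i by rewrite -PQE mulmxA QPE mul1mx.
have EP i : E i *m P i = P i by rewrite -PQE -mulmxA QPE mulmx1.
exists (fun i X => Q i *m X *m P i); split.
- by move=> i k X Y _ _; rewrite mulmxDr mulmxDl -scalemxAr -scalemxAl.
- move=> i X Y TX TY; rewrite -{1}(EP i) !mulmxA -(mulmxA _ Y) (Ecomm _ _ TY).
  by rewrite -PQE !mulmxA.
- by move=> i; rewrite mulmx1.
(* Injectivity: multiplying X by the resolution of 1 rebuilds it from its components. *)
- have recX X : commutant G rho X -> X = \sum_i c i *: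
      (\sum_(g in G) rho g *m (P i *m (Q i *m X *m P i) *m Q i) *m rho g^-1%g).
    move=> TX; rewrite -{1}(mulmx1 X) -sumE mulmx_sumr; apply: eq_bigr => i _.
    rewrite -scalemxAr mulmx_sumr; congr (_ *: _); apply: eq_bigr => g Gg.
    have -> : P i *m (Q i *m X *m P i) *m Q i = X *m E i.
      by rewrite !mulmxA PQE -mulmxA PQE -(Ecomm i X TX) -mulmxA EE.
    by rewrite !mulmxA TX.
  move=> X Y TX TY eqXY; rewrite (recX X TX) (recX Y TY).
  by apply: eq_bigr => i _; rewrite eqXY.
move=> Y.
pose X := \sum_i c i *:
  (\sum_(g in G) rho g *m (P i *m Y i *m Q i) *m rho g^-1%g).
exists X.
  move=> h Gh; rewrite /X mulmx_suml mulmx_sumr; apply: eq_bigr => i _.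
  rewrite -scalemxAl -scalemxAr; congr (_ *: _); rewrite mulmx_suml mulmx_sumr.
  rewrite (reindex_inj (mulgI h)) /=.
  apply: eq_big => [g|g]; rewrite groupMl // => Gg.
  by rewrite rhoM // -!mulmxA -rhoM ?groupV ?groupM // invMg -mulgA mulVg mulg1.
have Qmid i j g Z : Q j *m (rho g *m (P i *m Z *m Q i) *m rho g^-1%g) *m P j =
    (Q j *m (E j *m rho g *m E i) *m P i) *m Z *m (Q i *m rho g^-1%g *m P j).
  rewrite !mulmxA QE -!mulmxA; congr (_ *m (_ *m _)).
  by rewrite !mulmxA EP.
have sum_diag j (Z : forall i, 'M[C]_(m i)) :
    Q j *m (\sum_i c i *:
      (\sum_(g in G) rho g *m (P i *m Z i *m Q i) *m rho g^-1%g)) *m P j =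
    Q j *m (c j *:
      (\sum_(g in G) rho g *m (P j *m Z j *m Q j) *m rho g^-1%g)) *m P j.
  rewrite mulmx_sumr mulmx_suml (bigD1 j) //= [X in _ + X]big1 ?addr0 // => i ij.
  rewrite -scalemxAr -scalemxAl mulmx_sumr mulmx_suml big1 ?scaler0 // => g Gg.
  by rewrite Qmid E0 1?eq_sym // mulmx0 !mul0mx.
move=> j; rewrite /X sum_diag.
(* What remains is [Y j] times a scalar that does not depend on Y. The family Y = 1 gives its value:
   there the sum is 1 by [sumE]. *)
have : Q j *m 1%:M *m P j = 1%:M by rewrite mulmx1.
rewrite -sumE; under eq_bigr => i _ do
  under eq_bigr => g _ do rewrite -PQE -{1}(mulmx1 (P i)).
rewrite (sum_diag j (fun=> 1%:M)) => sum1.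
rewrite -[RHS]mul1mx -sum1 -!scalemxAr -!scalemxAl; congr (_ *: _).
rewrite !mulmx_sumr !mulmx_suml; apply: eq_bigr => g Gg; rewrite !Qmid.
have [l El] := Escal j g Gg; have [l' El'] := Escal j _ (groupVr Gg).
have -> : Q j *m rho g^-1%g *m P j = l'%:M.
  rewrite -(QE j) -(EP j) !mulmxA -(mulmxA (Q j)) -(mulmxA (Q j)) El'.
  by rewrite -scalemxAr -scalemxAl QE QPE scalemx1.
rewrite El -scalemxAr QE -scalemxAl QPE scalemx1.
by rewrite !mul_mx_scalar scale1r -scalemxAl.
Qed.

(** * The conjugation representation and its commutant *)

Section ConjugationRepresentation.
Variables (C : numFieldType) (gT : finGroupType) (G : {group gT}).
Implicit Types (g h x : gT) (i j : 'I_#|G|) (X : 'M[C]_#|G|).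

Definition conj_mx g : 'M[C]_#|G| :=
  \matrix_(i, j) (enum_val j == enum_val i ^ g)%g%:R.

Lemma enum_valS x : x \in G -> exists i : 'I_#|G|, enum_val i = x.
Proof. by move=> Gx; exists (enum_rank_in Gx x); rewrite enum_rankK_in. Qed.

Lemma conj_mx_mull X g i i' j :
  enum_val i' = (enum_val i ^ g)%g -> (conj_mx g *m X) i j = X i' j.
Proof.
move=> ei; rewrite mxE (bigD1 i') //= mxE ei eqxx mul1r big1 ?addr0 // => k ki.
rewrite mxE -ei (inj_eq enum_val_inj) (negPf ki) mul0r //.
Qed.

Lemma conj_mx_mulr X g i j j' :
  enum_val j' = (enum_val j ^ g)%g -> (X *m conj_mx g) i j' = X i j.
Proof.
move=> ej; rewrite mxE (bigD1 j) //= mxE ej eqxx mulr1 big1 ?addr0 // => k kj.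
by rewrite mxE ej (inj_eq (conjg_inj g)) (inj_eq enum_val_inj) eq_sym (negPf kj) mulr0.
Qed.

Lemma conj_mxM : {in G &, forall g h, conj_mx (g * h)%g = conj_mx g *m conj_mx h}.
Proof.
move=> g h Gg Gh; apply/matrixP=> i j.
have [i' ei] := enum_valS (groupJ (enum_valP i) Gg).
by rewrite (conj_mx_mull _ _ ei) !mxE ei conjgM.
Qed.

Lemma conj_mx1 : conj_mx 1%g = 1%:M.
Proof.
by apply/matrixP=> i j; rewrite !mxE conjg1 (inj_eq enum_val_inj) eq_sym.
Qed.

Lemma card_cent1_sum (H : {group gT}) x :
  #|'C_H[x]%g|%:R = \sum_(g in H) (g \in 'C[x])%g%:R :> C.
Proof.
rewrite -sum1_card natr_sum [RHS](bigID (mem 'C[x]%g)) /=.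
rewrite [X in _ = _ + X]big1 ?addr0; last by move=> g /andP[_ /negPf->].
by apply: eq_big => [g|g]; rewrite inE // => /andP[_ ->].
Qed.

Lemma mxtrace_conj_mx g : g \in G -> \tr (conj_mx g) = #|'C_G[g]%g|%:R.
Proof.
move=> Gg; rewrite card_cent1_sum /mxtrace.
rewrite (big_enum_val (fun x => (x \in 'C[g])%g%:R)).
apply: eq_bigr => i _; rewrite mxE; congr (_%:R).
by rewrite -(inj_eq (mulgI g)) -conjgC; 
congr (nat_of_bool _); apply/eqP/cent1P; rewrite /commute => ->.
Qed.

Lemma commutant_conj_mxP X :
  commutant G conj_mx X <->
  (forall g i j i' j', g \in G -> enum_val i' = (enum_val i ^ g)%g ->
     enum_val j' = (enum_val j ^ g)%g -> X i' j' = X i j).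
Proof.
split=> [comX g i j i' j' Gg ei ej | invX g Gg].
  by rewrite -(conj_mx_mull X j' ei) -(comX g Gg) (conj_mx_mulr X i ej).
apply/matrixP=> i j'.
have [i' ei] := enum_valS (groupJ (enum_valP i) Gg).
have [j ej] := enum_valS (groupJ (enum_valP j') (groupVr Gg)).
have ej' : enum_val j' = (enum_val j ^ g)%g by rewrite ej conjgKV.
by rewrite (conj_mx_mull _ _ ei) (conj_mx_mulr _ _ ej'); 
exact/esym/(invX g).
Qed.

Lemma terwilliger_commutant X : terwilliger C G X -> commutant G conj_mx X.
Proof.
elim=> {X} [X| | c X Y _ comX _ comY | X Y _ comX _ comY]; first case=> K clK eX.
- have KJ x g : g \in G -> (x ^ g \in K)%g = (x \in K).
    move=> Gg; have /imsetP[z Gz ->] := clK.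
    by rewrite class_sym (classGidl _ Gg) class_sym.
  apply/commutant_conj_mxP => g i j i' j' Gg ei ej.
  case: eX => ->; rewrite !mxE ei.
    by rewrite ej -conjVg -conjMg KJ.
  rewrite KJ // -(inj_eq enum_val_inj) ei ej.
  by rewrite (inj_eq (conjg_inj g)) (inj_eq enum_val_inj).
- by move=> g _; rewrite mul1mx mulmx1.
- by move=> g Gg; rewrite mulmxDl mulmxDr -scalemxAl -scalemxAr comX ?comY.
by move=> g Gg; rewrite -mulmxA comY // !mulmxA comX.
Qed.

Lemma gen_subalgebra_sum (S : 'M[C]_#|G| -> Prop) (I : finType)
    (F : I -> 'M[C]_#|G|) :
  (forall k, gen_subalgebra S (F k)) -> gen_subalgebra S (\sum_k F k).
Proof.
move=> SF; have S0 : gen_subalgebra S 0.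
  by rewrite -(addNr 1%:M) -scaleN1r; apply: gen_subalgebraP; apply: gen_subalgebra1.
apply: big_ind => // X Y SX SY.
by rewrite -[X]scale1r; apply: gen_subalgebraP.
Qed.

(* Triple regularity: [T(G)] is all of the commutant as soon as the classes
   of [x], [z x^-1] and [z] determine the orbit of [(x, z)]. *)
Lemma commutant_terwilliger X :
  (forall x z x' z', x \in G -> z \in G -> x' \in x ^: G -> z' \in z ^: G ->
     z' * x'^-1 \in (z * x^-1) ^: G ->
     exists2 g, g \in G & (x' = x ^ g /\ z' = z ^ g))%g ->
  commutant G conj_mx X -> terwilliger C G X.
Proof.
move=> orbit3 comX.
pose cl i := (enum_val i ^: G)%g.
pose cl2 i j := ((enum_val j * (enum_val i)^-1) ^: G)%g.
pose same i j i' j' := [&& cl i' == cl i, cl j' == cl j & cl2 i' j' == cl2 i j].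
pose N i j := #|[pred k : 'I_#|G| * 'I_#|G| | same i j k.1 k.2]|.
have sameX i j i' j' : same i j i' j' -> X i' j' = X i j.
  case/and3P => /eqP ei /eqP ej /eqP eij.
  have [|||||g Gg [eg1 eg2]] :=
    orbit3 (enum_val i) (enum_val j) (enum_val i') (enum_val j').
  - exact: enum_valP.
  - exact: enum_valP.
  - by rewrite -[(_ ^: _)%g]ei class_refl.
  - by rewrite -[(_ ^: _)%g]ej class_refl.
  - by rewrite -[(_ ^: _)%g]eij class_refl.
  by move/commutant_conj_mxP: comX => /(_ g i j i' j' Gg eg1 eg2).
have sameN i j i' j' : same i j i' j' -> N i' j' = N i j.
  case/and3P => /eqP ei /eqP ej /eqP eij; apply: eq_card => k.
  by rewrite !inE /same ei ej eij.
have N0 i j : (N i j)%:R != 0 :> C.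
  rewrite pnatr_eq0 -lt0n; apply/card_gt0P; exists (i, j).
  by rewrite inE /same !eqxx.
pose T i j := class_idem C G (cl i) *m class_mx C G (cl2 i j) *m class_idem C G (cl j).
have TE i j i' j' : T i j i' j' = (same i j i' j')%:R.
  rewrite /T mxE (bigD1 j') //= big1 ?addr0 => [|k kj]; last first.
    by rewrite [X in _ * X]mxE (negPf kj) mulr0.
  rewrite mxE (bigD1 i') //= big1 ?addr0 => [|k ki]; last first.
    by rewrite [X in X * _]mxE eq_sym (negPf ki) mul0r.
  rewrite !mxE !eqxx /=.
  rewrite /same /cl /cl2 !(sameP eqP class_eqP) /=.
  by do 3?case: (_ \in _); rewrite ?mulr0 ?mulr1 ?mul0r.
(* [T i j] is the 0/1 matrix of the pairs having the same three classes as (i, j). Summing over all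
   pairs instead of representatives repeats each such matrix [N i j] times, whence the division. *)
rewrite [X](_ : _ = \sum_k (X k.1 k.2 / (N k.1 k.2)%:R) *: T k.1 k.2); last first.
  apply/matrixP=> i j; rewrite summxE.
  under eq_bigr => k _ do rewrite mxE TE mulr_natr mulrb.
  rewrite -big_mkcond /= (eq_bigr (fun=> X i j / (N i j)%:R)); last first.
    by move=> k sk; rewrite (sameX _ _ _ _ sk) (sameN _ _ _ _ sk).
  rewrite sumr_const [X in _ *+ X](_ : _ = N i j).
    by rewrite -[RHS]mulr_natr divfK ?N0.
  apply: eq_card => k; rewrite !unfold_in /same /=.
  by congr [&& _, _ & _]; apply: eq_sym.
apply: gen_subalgebra_sum => k.
have clG i : cl i \in classes G by apply: mem_classes; apply: enum_valP.
have cl2G i j : cl2 i j \in classes G.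
  by apply: mem_classes; rewrite groupM ?groupV ?enum_valP.
have S0 : terwilliger C G 0.
  by rewrite -(addNr 1%:M) -scaleN1r; apply: gen_subalgebraP; apply: gen_subalgebra1.
rewrite -[_ *: _]addr0; apply: gen_subalgebraP => //.
apply: gen_subalgebraM; [apply: gen_subalgebraM |];
  apply: gen_subalgebra_gen; [exists (cl k.1) | exists (cl2 k.1 k.2) | exists (cl k.2)];
  by [| left | right].
Qed.

End ConjugationRepresentation.

(** * Orbits of pairs for an abelian subgroup of index 2 *)

Section Index2.
Local Open Scope group_scope.
Variables (gT : finGroupType) (G A : {group gT}).
Hypotheses (abA : abelian A) (sAG : A \subset G) (iAG : #|G : A| = 2%N).

Lemma index2_mem x g :
  x \in G -> x \notin A -> g \in G -> (g \in A) = (g * x^-1 \notin A).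
Proof.
move=> Gx nAx Gg; have DAx : x \in G :\: A by rewrite inE nAx.
have := rcoset_index2 sAG iAG DAx; move/setP/(_ g).
by rewrite mem_rcoset !inE Gg andbT => ->; rewrite negbK.
Qed.

Lemma abelian_conj_fix x g : x \in A -> g \in A -> x ^ g = x.
Proof. by move=> Ax Ag; apply/conjg_fixP/commgP/(centsP abA). Qed.

Lemma index2_conj_in x z g :
    x \in G -> x \notin A -> z \in A -> g \in G ->
  z ^ g = z \/ z ^ g = z ^ x.
Proof.
move=> Gx nAx Az Gg; have [Ag | nAg] := boolP (g \in A).
  by left; apply: abelian_conj_fix.
right; move: nAg; rewrite (index2_mem Gx nAx Gg) negbK => Agx.
by rewrite -{1}(mulgKV x g) conjgM (abelian_conj_fix Az Agx).
Qed.

(** For g outside A the element z^-1 g lies in A and conjugates z as g does, because z commutes with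
    itself. Conjugators taken in A are useful since they fix every x in A. *)
Lemma index2_conj_out z g :
  z \in G -> z \notin A -> g \in G -> exists2 c, c \in A & z ^ g = z ^ c.
Proof.
move=> Gz nAz Gg; have [Ag | nAg] := boolP (g \in A); first by exists g.
exists (z^-1 * g); last by rewrite conjgM [z ^ z^-1]conjgE mulgV mulg1 invgK.
rewrite -groupV invMg invgK.
move: nAg; rewrite -groupV (@index2_mem z^-1) ?groupV //.
by rewrite negbK invgK.
Qed.

(* When [x] is outside [A], conjugation by [x] is the only nontrivial one on
   [A], and [x] fixes itself. *)
Lemma index2_orbit3_fix x z z' :
    x \in G -> z \in G -> z' \in z ^: G -> z' * x^-1 \in (z * x^-1) ^: G ->
  exists2 g, g \in 'C_G[x] & z' = z ^ g.
Proof.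
move=> Gx Gz /imsetP[g Gg ->] /imsetP[h Gh].
have inC c : c \in G -> x ^ c = x -> c \in 'C_G[x].
  by move=> Gc xc; rewrite inE Gc; apply/cent1P; rewrite /commute (conjgC x c) xc.
have [Ax | nAx] := boolP (x \in A); last first.
  have xC : x \in 'C_G[x] by apply: (inC x Gx); rewrite conjgE mulKg.
  have [Az _ | nAz] := boolP (z \in A).
    have [->|->] := index2_conj_in Gx nAx Az Gg; [exists 1; rewrite ?conjg1 // |].
    by exists x.
  (* Now z x^-1 is in A, so its only conjugates are itself and its conjugate by x; as x fixes
     itself, these correspond to z' = z and z' = z ^ x. *)
  have Au : z * x^-1 \in A.
    by move: nAz; rewrite (index2_mem Gx nAx Gz) negbK.
  have [->|->] := index2_conj_in Gx nAx Au Gh => /(canRL (mulgKV x)).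
    by rewrite mulgKV => ->; exists 1; rewrite ?conjg1.
  by move=> ->; exists x => //; rewrite conjMg conjVg [x ^ x]conjgE mulKg mulgKV.
have [Az | nAz] := boolP (z \in A); last first.
  move=> _; have [c Ac ->] := index2_conj_out Gz nAz Gg.
  by exists c => //; apply: inC; [apply: (subsetP sAG) | apply: abelian_conj_fix].
have [Ag _ | nAg] := boolP (g \in A).
  by exists 1; rewrite ?conjg1 ?abelian_conj_fix.
(* With x and z in A and g outside, z x^-1 is conjugate only to itself, which forces z ^ g = z, and
   to its conjugate by g, which forces x ^ g = x. *)
have [->|->] := index2_conj_in Gg nAg (groupM Az (groupVr Ax)) Gh.
  by move/mulIg->; exists 1; rewrite ?conjg1.
by rewrite conjMg => /mulgI; rewrite conjVg => /invg_inj xg; exists g => //; apply: inC.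
Qed.

Lemma index2_orbit3 x z x' z' :
    x \in G -> z \in G -> x' \in x ^: G -> z' \in z ^: G ->
    z' * x'^-1 \in (z * x^-1) ^: G ->
  exists2 g, g \in G & x' = x ^ g /\ z' = z ^ g.
Proof.
move=> Gx Gz /imsetP[h Gh ->] z'z; rewrite -{1}(conjgKV h z') -conjVg -conjMg.
rewrite class_sym (classGidl _ Gh) class_sym => zx.
have z'hz : z' ^ h^-1 \in z ^: G.
  by rewrite class_sym (classGidl _ (groupVr Gh)) class_sym.
have [g /setIP[Gg /cent1P gx] zg] := index2_orbit3_fix Gx Gz z'hz zx.
exists (g * h); rewrite ?groupM // !conjgM -zg conjgKV; split=> //.
by congr (_ ^ h); apply/esym/conjg_fixP/commgP.
Qed.

End Index2.

(** * Linear characters of A and their eigenspaces *)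

Section Characters.
Variables (C : numClosedFieldType) (zeta : nat -> C).
Hypothesis zeta_prim : forall m, (0 < m)%N -> m.-primitive_root (zeta m).
Variables (gT : finGroupType) (A : {group gT}) (k : nat).
Variables (a : 'I_k -> gT) (q : 'I_k -> nat).
Hypotheses (abA : abelian A) (a_order : forall i, #[a i]%g = q i).
Hypothesis A_dprod : \big[dprod/1%g]_i <[a i]>%g = A.
Implicit Types (J t : 'I_k -> nat) (x z : gT).

Definition word t : gT := (\prod_i a i ^+ t i)%g.
Local Notation sg := (sigma zeta a q).

Lemma q_gt0 i : (0 < q i)%N. Proof. by rewrite -a_order. Qed.

Lemma base_mem i : a i \in A.
Proof.
have sub := bigdprodWY A_dprod; rewrite -sub mem_gen //.
by apply/bigcupP; exists i; rewrite ?cycle_id.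
Qed.

Lemma mem_word t : word t \in A.
Proof. by apply: group_prod => i _; rewrite groupX ?base_mem. Qed.

Lemma word_eq t t' : word t = word t' <-> forall i, t i = t' i %[mod q i].
Proof.
split=> [tt' i | tt']; last first.
  apply: eq_bigr => i _; apply/eqP.
  by rewrite eq_expg_mod_order a_order; apply/eqP.
have [c [_ _ uniq_c]] := mem_bigdprod A_dprod (mem_word t).
have tc := uniq_c _ (fun i _ => mem_cycle (a i) (t i)) erefl i isT.
have t'c := uniq_c _ (fun i _ => mem_cycle (a i) (t' i)) tt' i isT.
by apply/eqP; rewrite -a_order -eq_expg_mod_order tc -t'c.
Qed.

Lemma wordM t t' : word (fun i => t i + t' i)%N = (word t * word t')%g.
Proof.
suff [] : word t \in A /\ word (fun i => t i + t' i)%N = (word t * word t')%g by [].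
rewrite /word; elim/big_rec3: _ => [|i x z w _ [Az ->]]; first by rewrite mulg1.
have Ai m : (a i ^+ m)%g \in A by rewrite groupX ?base_mem.
split; first by rewrite groupM.
rewrite expgD -!mulgA; congr (_ * _)%g.
by rewrite !mulgA; congr (_ * _)%g; apply: (centsP abA).
Qed.

Lemma coordsK x : x \in A -> word (coords a x) = x.
Proof.
move=> Ax; rewrite /coords; case: pickP => [t /eqP->|] //.
have [c [ac -> _]] := mem_bigdprod A_dprod Ax.
have m_ex i : exists m : 'I_#|gT|, c i == (a i ^+ m)%g.
  have [m m_lt cE] := cyclePmin (ac i isT).
  have mM : (m < #|gT|)%N by apply: leq_trans m_lt (max_card _).
  by exists (Ordinal mM); rewrite cE.
pose t : {ffun 'I_k -> 'I_#|gT|} := [ffun i => xchoose (m_ex i)].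
case/(_ t)/eqP; apply: eq_bigr => i _.
by rewrite ffunE; apply/eqP/(xchooseP (m_ex i)).
Qed.

(** Frees [sigma] from the choice made in [coords]: two exponents of [a i] agree modulo q i, the
    order of [zeta (q i)]. *)
Lemma sigma_word J t : sg J (word t) = \prod_i zeta (q i) ^+ (J i * t i).
Proof.
apply: eq_bigr => i _; apply/eqP.
rewrite (eq_prim_root_expr (zeta_prim (q_gt0 i))).
have /word_eq/(_ i) e := coordsK (mem_word t).
by rewrite -modnMmr e modnMmr.
Qed.

Lemma sigma1 J : sg J 1%g = 1.
Proof.
have -> : 1%g = word (fun=> 0%N) by rewrite /word big1 // => i _; rewrite expg0.
by rewrite sigma_word big1 // => i _; rewrite muln0 expr0.
Qed.

Lemma sigmaM J : {in A &, {morph sg J : x z / (x * z)%g >-> x * z}}.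
Proof.
move=> x z Ax Az; rewrite -[in LHS](coordsK Ax) -[in LHS](coordsK Az) -wordM.
rewrite sigma_word -big_split; apply: eq_bigr => i _.
by rewrite mulnDr exprD.
Qed.

Lemma word_delta i m : word (fun j => if j == i then m else 0)%N = (a i ^+ m)%g.
Proof.
rewrite -[RHS](big_pred1_eq mulg i (fun j => a j ^+ m)%g) big_mkcond.
by apply: eq_bigr => j _; case: eqP.
Qed.

Lemma sigma_genX J i m : sg J (a i ^+ m)%g = zeta (q i) ^+ (J i * m).
Proof.
rewrite -word_delta sigma_word (bigD1 i) //= eqxx big1 ?mulr1 // => j /negPf->.
by rewrite muln0.
Qed.

Lemma sigma_inj J J' :
  (forall i, J i < q i)%N -> (forall i, J' i < q i)%N ->
  {in A, sg J =1 sg J'} -> J =1 J'.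
Proof.
move=> Jq J'q eqJ i; have := eqJ _ (base_mem i).
rewrite -[a i]expg1 !sigma_genX !muln1 => /eqP.
by rewrite (eq_prim_root_expr (zeta_prim (q_gt0 i))) !modn_small // => /eqP.
Qed.

Lemma card_words : #|A| = (\prod_i q i)%N.
Proof.
by rewrite -(bigdprod_card A_dprod); apply: eq_bigr => i _; rewrite -a_order.
Qed.

Lemma q_leq i : (q i <= #|gT|)%N.
Proof. by rewrite -a_order max_card. Qed.

(** The bound q i depends on i; the common codomain puts all character tuples in one finite type and
    loses none, as q i <= #|gT|. *)
Definition tuples := [set J : {ffun 'I_k -> 'I_#|gT|} | [forall i, J i < q i]%N].

Lemma tuplesP (J : {ffun 'I_k -> 'I_#|gT|}) :
  reflect (forall i, J i < q i)%N (J \in tuples).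
Proof. by rewrite inE; apply: forallP. Qed.

(** The sum factors into one geometric sum of roots of unity for each cyclic factor. *)
Lemma sum_sigma_tuples x : x \in A ->
  \sum_(J in tuples) sg (fun i => J i : nat) x = (x == 1%g)%:R * #|A|%:R.
Proof.
move=> Ax; pose F i (j : 'I_#|gT|) := zeta (q i) ^+ (j * coords a x i).
rewrite (eq_bigl (fun J : {ffun 'I_k -> 'I_#|gT|} =>
    J \in family (fun i => [pred j : 'I_#|gT| | j < q i]%N))); last first.
  by move=> J; apply/tuplesP/familyP.
rewrite -(bigA_distr_big_dep (fun i => [pred j : 'I_#|gT| | j < q i]%N) F) /=.
have sumF i : \sum_(j < #|gT| | (j < q i)%N) F i j =
      (q i %| coords a x i)%N%:R * (q i)%:R.
  rewrite /F -(big_ord_widen _ (fun j => zeta (q i) ^+ (j * coords a x i)) (q_leq i)).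
  have zP := zeta_prim (q_gt0 i); under eq_bigr => j _ do rewrite mulnC exprM.
  have [dvd | ndvd] := boolP (q i %| coords a x i)%N.
    have /eqP z1 : zeta (q i) ^+ coords a x i == 1 by rewrite -(prim_order_dvd zP).
    by under eq_bigr => j _ do rewrite z1 expr1n; rewrite sumr_const card_ord mul1r.
  rewrite mul0r; apply: (mulfI (_ : zeta (q i) ^+ coords a x i - 1 != 0)).
    by rewrite subr_eq0 -(prim_order_dvd zP).
  by rewrite -subrX1 mulr0 -exprM mulnC exprM (prim_expr_order zP) expr1n subrr.
rewrite (eq_bigr _ (fun i _ => sumF i)) big_split /= card_words natr_prod.
congr (_ * _).
have [x1|xn1] := eqVneq x 1%g.
  rewrite big1 // => i _; rewrite x1.
  have e1 : 1%g = word (fun=> 0%N).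
    by rewrite /word big1 // => j _; rewrite expg0.
  have /word_eq/(_ i) := etrans (coordsK (group1 A)) e1.
  by rewrite mod0n => /eqP; rewrite -/(dvdn _ _) => ->.
have /existsP[i ndvd] : [exists i, ~~ (q i %| coords a x i)%N].
  apply: contraNT xn1; rewrite negb_exists => /forallP all_dvd.
  rewrite -(coordsK Ax) /word big1 // => i _; apply/eqP.
  by have := all_dvd i; rewrite negbK -a_order order_dvdn.
by rewrite (bigD1 i) //= (negPf ndvd) mul0r.
Qed.

(** * The action of f on exponents and on characters *)

Variables (f : {perm gT}) (s : 'I_k -> int).
Hypothesis f_aut : f \in Aut A.
Hypothesis f_diag : forall i x, x \in <[a i]>%g -> f x = zexpg x (s i).
Local Notation d := (fix_ord q s).

(** A natural representative of the possibly negative s i modulo q i. *)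
Let sn i := `|(s i %% q i)%Z|%N.

Lemma zexpg_modz x (m : int) (r : nat) :
  (0 < r)%N -> (x ^+ r = 1)%g -> zexpg x m = (x ^+ `|(m %% r)%Z|)%g.
Proof.
move=> r_gt0 xr1.
have r0 : r%:Z != 0 by rewrite -lt0n.
have mE : (m %% r)%Z = `|(m %% r)%Z|%N by rewrite gez0_abs ?modz_ge0.
have mdiv := divz_eq m r.
rewrite mE in mdiv; move: `|_|%N mdiv => t {mE} mE.
case: m mE => m mE /=.
  have xX (j : nat) : (x ^+ (j * r) = 1)%g by rewrite mulnC expgM xr1 expg1n.
  case: (Posz m %/ r)%Z mE => j.
    rewrite -PoszM -PoszD => -[->]; by rewrite expgD xX mul1g.
  rewrite NegzE mulNr -PoszM => e.
  have : (m + j.+1 * r = t)%N by apply/eqP; rewrite -eqz_nat PoszD e addrAC addNr add0r.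
  by move=> <-; rewrite expgD xX mulg1.
have xX (j : nat) : (x ^+ (j * r) = 1)%g by rewrite mulnC expgM xr1 expg1n.
apply: (mulgI (x ^+ m.+1)%g); rewrite mulgV -expgD; apply/esym.
case: (Negz m %/ r)%Z mE => j.
  by rewrite NegzE -PoszM -PoszD.
rewrite !NegzE mulNr -PoszM => e.
have -> : (m.+1 + t = j.+1 * r)%N.
  by apply/eqP; rewrite -eqz_nat PoszD -[X in X + _]opprK e opprD opprK subrK.
by rewrite xX.
Qed.

Lemma f_word t : f (word t) = word (fun i => t i * sn i)%N.
Proof.
suff [] : word t \in A /\ f (word t) = word (fun i => t i * sn i)%N by [].
rewrite /word; elim/big_rec2: _ => [|i x z _ [Ax fx]].
  by rewrite group1 -(autmE f_aut) morph1.
have Ai : (a i ^+ t i)%g \in A by rewrite groupX ?base_mem.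
rewrite groupM // (morphicP (Aut_morphic f_aut)) // fx; split=> //.
congr (_ * _)%g; rewrite (f_diag (mem_cycle _ _)) expgM; apply: zexpg_modz.
  exact: q_gt0.
by rewrite -expgM mulnC expgM -a_order expg_order expg1n.
Qed.

Lemma fix_ord_dvd i : (d i %| q i)%N. Proof. exact: dvdn_gcdr. Qed.

Lemma fix_ord_gt0 i : (0 < d i)%N.
Proof. by rewrite gcdn_gt0 q_gt0 orbT. Qed.

(** The congruence says that q i divides m (s i - 1), equivalently m times the gcd d i. It serves
    twice: for m an exponent of a fixed element ([f_fixP]) and for m an entry of an invariant
    character ([conj_tuple_fixP]). *)
Lemma mul_sn_modP i m : (m * sn i = m %[mod q i])%N <-> (q i %/ d i %| m)%N.
Proof.
have q0 : (q i)%:Z != 0 by rewrite -lt0n q_gt0.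
have snE : (sn i)%:Z = (s i %% q i)%Z by rewrite gez0_abs ?modz_ge0.
have -> : (q i %/ d i %| m)%N = (q i %| m * `|s i - 1|)%N.
  rewrite -(dvdn_pmul2r (fix_ord_gt0 i)) divnK ?fix_ord_dvd //.
  by rewrite /fix_ord muln_gcdr dvdn_gcd [(q i %| m * q i)%N]dvdn_mull ?andbT.
have -> : (q i %| m * `|s i - 1|)%N = (q i %| m%:Z * (s i - 1))%Z.
  by rewrite dvdzE abszM.
rewrite mulrBr mulr1 -eqz_mod_dvd -modzMmr -snE -PoszM !modz_nat eqz_nat.
by split=> [->|/eqP].
Qed.

Lemma f_fixP t : f (word t) = word t <-> forall i, (q i %/ d i %| t i)%N.
Proof.
rewrite f_word word_eq; split=> H i; have := H i; by rewrite mul_sn_modP.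
Qed.

(** The tuple of the character [sigma J] composed with f, reduced so that it again indexes a
    character. *)
Definition conj_tuple J i := ((J i * sn i) %% q i)%N.

Lemma conj_tuple_lt J i : (conj_tuple J i < q i)%N.
Proof. by rewrite ltn_mod q_gt0. Qed.

Lemma sigma_f J x : x \in A -> sg J (f x) = sg (conj_tuple J) x.
Proof.
move=> Ax; rewrite -(coordsK Ax) f_word !sigma_word; apply: eq_bigr => i _.
apply/eqP; rewrite (eq_prim_root_expr (zeta_prim (q_gt0 i))).
by rewrite modnMml mulnCA mulnC mulnAC.
Qed.

Lemma conj_tuple_fixP J : (forall i, J i < q i)%N ->
  conj_tuple J =1 J <-> (forall i, q i %/ d i %| J i)%N.
Proof.
move=> Jq; split=> H i.
  by apply/mul_sn_modP; rewrite (modn_small (Jq i)); apply: H.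
by rewrite /conj_tuple; have /mul_sn_modP -> := H i; rewrite modn_small.
Qed.

Lemma quo_gt0 i : (0 < q i %/ d i)%N.
Proof. by rewrite divn_gt0 ?fix_ord_gt0 // dvdn_leq ?q_gt0 ?fix_ord_dvd. Qed.

(** The fixed points of f are generated by the powers of [a i] with exponent q i / d i, where
    [sigma J] is trivial iff q i divides J i (q i / d i). This is the meaning of the divisibility
    conditions in the block sizes. *)
Lemma sigma_fixedP J :
  (forall x, x \in A -> f x = x -> sg J x = 1) <-> (forall i, d i %| J i)%N.
Proof.
have dvdP i : (d i %| J i)%N = (q i %| J i * (q i %/ d i))%N.
  by rewrite -(dvdn_pmul2r (quo_gt0 i)) [(d i * _)%N]mulnC divnK ?fix_ord_dvd.
split=> [H i | H x Ax fx].
  rewrite dvdP (prim_order_dvd (zeta_prim (q_gt0 i))) -sigma_genX.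
  apply/eqP/H; first by rewrite groupX ?base_mem.
  have -> : (a i ^+ (q i %/ d i))%g =
      word (fun j => if j == i then q i %/ d i else 0)%N.
    by rewrite word_delta.
  by apply/f_fixP => j; case: eqP => [->|].
move: fx; rewrite -(coordsK Ax) => /f_fixP fx; rewrite sigma_word big1 // => i _.
apply/eqP; rewrite -(prim_order_dvd (zeta_prim (q_gt0 i))).
have := H i; rewrite dvdP => /dvdn_trans->//.
by rewrite dvdn_mul.
Qed.

Lemma sum_sigma_group (H : {group gT}) J : H \subset A ->
  \sum_(x in H) sg J x =
    if [forall x in H, sg J x == 1] then #|H|%:R else 0.
Proof.
move=> sHA; case: ifPn => [/forallP H1 | ].
  rewrite -sum1_card natr_sum; apply: eq_bigr => x Hx.
  by have := H1 x; rewrite Hx => /eqP.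
rewrite negb_forall => /existsP[z]; rewrite negb_imply => /andP[Hz nz1].
apply: (mulfI (_ : sg J z - 1 != 0)); first by rewrite subr_eq0.
rewrite mulr0 mulrBl mul1r; apply/eqP; rewrite subr_eq0; apply/eqP.
rewrite mulr_sumr [RHS](reindex_inj (mulgI z)) /=.
apply: eq_big => x; first by rewrite groupMl.
by move=> Hx; rewrite sigmaM // (subsetP sHA).
Qed.

(** * Centralizers in G, eigenprojections and their traces *)

Variables (G : {group gT}) (b y : gT).
Hypotheses (sAG : A \subset G) (iAG : #|G : A|%g = 2%N).
Hypotheses (Gb : b \in G) (nAb : b \notin A) (Ay : y \in A) (b2 : (b ^+ 2 = y)%g).
Hypothesis fE : {in A, forall x, b * x * b^-1 = f x}%g.
Local Notation rho := (conj_mx C G).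

Lemma f_in x : x \in A -> f x \in A.
Proof. by move=> Ax; rewrite -(autmE f_aut) Aut_closed. Qed.

Lemma f_invol x : x \in A -> f (f x) = x.
Proof.
move=> Ax; rewrite -fE ?f_in // -fE // !mulgA.
rewrite -[LHS]mulgA -invMg -expg2 b2.
by rewrite (centsP abA y Ay x Ax) mulgK.
Qed.

Lemma f_y : f y = y.
Proof. by rewrite -fE // -b2 expg2 mulgA mulgK. Qed.

Lemma bM x : x \in A -> (b * x = f x * b)%g.
Proof. by move=> Ax; rewrite -fE // mulgKV. Qed.

Lemma big_index2 (V : nmodType) (F : gT -> V) :
  \sum_(g in G) F g = \sum_(x in A) F x + \sum_(x in A) F (x * b)%g.
Proof.
rewrite (bigID (mem A)) /=; congr (_ + _).
  apply: eq_bigl => g; rewrite andbC.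
  by case: (boolP (g \in A)) => // /(subsetP sAG) ->.
rewrite (reindex_inj (mulIg b)) /=; apply: eq_bigl => x.
apply/andP/idP => [[Gxb]|Ax].
  by rewrite (index2_mem sAG iAG Gb nAb Gxb) mulgK negbK.
have Gxb : (x * b)%g \in G by rewrite groupM // (subsetP sAG).
by rewrite (index2_mem sAG iAG Gb nAb Gxb) mulgK negbK.
Qed.

Lemma card_cent1_in x : x \in A ->
  #|'C_G[x]%g|%:R = #|A|%:R + (f x == x)%:R * #|A|%:R :> C.
Proof.
move=> Ax; rewrite card_cent1_sum big_index2; congr (_ + _).
  rewrite -sum1_card natr_sum; apply: eq_bigr => c Ac; congr (_%:R).
  by apply/eqP; rewrite eqb1; apply/cent1P/(centsP abA).
rewrite mulr_natr -sumr_const; apply: eq_bigr => c Ac; congr (nat_of_bool _)%:R.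
have cbx : (c * b * x = c * f x * b)%g by rewrite -mulgA bM // mulgA.
have xcb : (x * (c * b) = c * x * b)%g by rewrite mulgA (centsP abA x).
apply/cent1P/eqP; rewrite /commute cbx xcb; last by move->.
by move/mulIg/mulgI.
Qed.

(** An element c of A commutes with x b iff it commutes with b. As x b commutes with itself, its
    centralizer outside A consists of the x c b with the same c, which gives the factor 2. *)
Lemma card_cent1_out x : x \in A ->
  #|'C_G[(x * b)%g]%g|%:R = #|'C_A[b]%g|%:R *+ 2 :> C.
Proof.
move=> Ax; have Gx := subsetP sAG x Ax.
rewrite card_cent1_sum big_index2 mulr2n; congr (_ + _).
  rewrite card_cent1_sum; apply: eq_bigr => c Ac; congr (nat_of_bool _)%:R.
  have e1 : (c * (x * b) = x * (c * b))%g.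
    by rewrite !mulgA (centsP abA c).
  have e2 : (x * b * c = x * (b * c))%g by rewrite mulgA.
  apply/cent1P/cent1P; rewrite /commute e1 e2; last by move->.
  by move/mulgI.
rewrite (reindex_inj (mulgI x)) card_cent1_sum /=.
apply: eq_big => c; rewrite groupMl // => Ac; congr (nat_of_bool _)%:R.
have e1 : (x * c * b * (x * b) = x * f x * (c * b) * b)%g.
  rewrite !mulgA -(mulgA _ b x) bM // !mulgA -(mulgA x).
  by rewrite (centsP abA c Ac _ (f_in Ax)) !mulgA.
have e2 : (x * b * (x * c * b) = x * f x * (b * c) * b)%g.
  by rewrite !mulgA -(mulgA _ b x) bM // !mulgA.
by apply/cent1P/cent1P; rewrite /commute e1 e2; [move/mulIg/mulgI | move->].
Qed.

(* The projection onto the [sigma J]-eigenspace of [A]. *)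
Definition eJ J : 'M[C]_#|G| :=
  (#|A|%:R)^-1 *: \sum_(x in A) sg J x^-1%g *: rho x.

Let A0 : #|A|%:R != 0 :> C.
Proof. by rewrite pnatr_eq0 -lt0n cardG_gt0. Qed.

Let inG x : x \in A -> x \in G. Proof. exact: subsetP sAG x. Qed.

Lemma sigmaV J x : x \in A -> sg J x^-1%g * sg J x = 1.
Proof. by move=> Ax; rewrite -sigmaM ?groupV // mulVg sigma1. Qed.

Lemma rho_eJ J x : x \in A -> rho x *m eJ J = sg J x *: eJ J.
Proof.
move=> Ax; rewrite /eJ -scalemxAr scalerA mulrC -scalerA; congr (_ *: _).
rewrite mulmx_sumr scaler_sumr [RHS](reindex_inj (mulgI x)) /=.
apply: eq_big => z; first by rewrite groupMl.
move=> Az; rewrite -scalemxAr scalerA conj_mxM ?inG //; congr (_ *: _).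
by rewrite invMg sigmaM ?groupV // mulrC -mulrA sigmaV // mulr1.
Qed.

Lemma eJ_rho J x : x \in A -> eJ J *m rho x = sg J x *: eJ J.
Proof.
move=> Ax; rewrite -rho_eJ // /eJ -scalemxAr -scalemxAl; congr (_ *: _).
rewrite mulmx_sumr mulmx_suml; apply: eq_bigr => z Az.
by rewrite -scalemxAr -scalemxAl -!conj_mxM ?inG // (centsP abA x).
Qed.

Lemma eJ_comm J X : commutant G rho X -> X *m eJ J = eJ J *m X.
Proof.
move=> comX; rewrite /eJ -scalemxAr -scalemxAl; congr (_ *: _).
rewrite mulmx_sumr mulmx_suml; apply: eq_bigr => z Az.
by rewrite -scalemxAr -scalemxAl comX ?inG.
Qed.

Lemma eJ_idem J : eJ J *m eJ J = eJ J.
Proof.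
rewrite {1}/eJ -scalemxAl mulmx_suml.
rewrite (eq_bigr (fun=> eJ J)) => [|x Ax]; last first.
  by rewrite -scalemxAl rho_eJ // scalerA sigmaV // scale1r.
by rewrite sumr_const -scaler_nat scalerA mulVf // scale1r.
Qed.

Lemma eJ_ortho J J' x :
  x \in A -> sg J x != sg J' x -> eJ J *m eJ J' = 0.
Proof.
move=> Ax; rewrite -subr_eq0 => J0.
have : eJ J *m rho x *m eJ J' = eJ J *m (rho x *m eJ J') by rewrite mulmxA.
rewrite eJ_rho // rho_eJ // -(scalemxAl (sg J x)) -(scalemxAr (sg J' x)) => /eqP.
by rewrite -subr_eq0 -scalerBl scaler_eq0 (negPf J0) => /eqP.
Qed.

Lemma eq_eJ J J' : {in A, sg J =1 sg J'} -> eJ J = eJ J'.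
Proof.
by move=> e; congr (_ *: _); apply: eq_bigr => x Ax; rewrite e ?groupV.
Qed.

Lemma rho_b_eJ J : rho b *m eJ J = eJ (conj_tuple J) *m rho b.
Proof.
rewrite /eJ -scalemxAr -scalemxAl; congr (_ *: _).
rewrite mulmx_sumr mulmx_suml [RHS](reindex_inj perm_inj (h := f)) /=.
have fA x : (f x \in A) = (x \in A).
  by apply: perm_closed; case/setIdP: f_aut.
apply: eq_big => x; first by rewrite fA.
move=> Ax; rewrite -scalemxAr -scalemxAl -!conj_mxM ?(inG Ax, inG (f_in Ax)) //.
have fV : (f x)^-1%g = f x^-1%g by rewrite -(autmE f_aut) morphV.
by rewrite bM // -sigma_f ?groupV ?f_in // fV f_invol ?groupV.
Qed.

Lemma sum_eJ : \sum_(J in tuples) eJ (fun i => J i : nat) = 1%:M.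
Proof.
rewrite /eJ -scaler_sumr exchange_big /=.
rewrite (eq_bigr (fun x => ((x == 1%g)%:R * #|A|%:R) *: rho x)) => [|x Ax]; last first.
  by rewrite -scaler_suml sum_sigma_tuples ?groupV // invg_eq1.
rewrite (bigD1 1%g) //= eqxx mul1r big1 ?addr0 => [|x /andP[_ /negPf->]]; last first.
  by rewrite mul0r scale0r.
by rewrite scalerA mulVf // scale1r conj_mx1.
Qed.

Lemma sum_sigmaV (H : {group gT}) J :
  \sum_(x in H) sg J x^-1%g = \sum_(x in H) sg J x.
Proof.
by rewrite (reindex_inj invg_inj) /=; apply: eq_big => x; rewrite ?groupV ?invgK.
Qed.

Lemma fE_cent x : x \in A -> (f x == x) = (x \in 'C[b]%g).
Proof.
move=> Ax; apply/eqP/cent1P; rewrite /commute bM //; last by move/mulIg.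
by move->.
Qed.

Lemma tr_eJ J : \tr (eJ J) = \sum_(x in A) sg J x + \sum_(x in 'C_A[b]%g) sg J x.
Proof.
rewrite /eJ mxtraceZ raddf_sum /=.
rewrite (eq_bigr (fun x => #|A|%:R * (sg J x^-1%g + (x \in 'C[b])%g%:R * sg J x^-1%g))).
  rewrite -mulr_sumr mulKf // big_split /= -!sum_sigmaV; congr (_ + _).
  rewrite (bigID (mem 'C[b]%g)) /= [X in _ + X]big1 ?addr0; last first.
    by move=> x /andP[_ /negPf->]; rewrite mul0r.
  by apply: eq_big => [x|x /andP[_ ->]]; rewrite ?in_setI ?mul1r.
move=> x Ax; rewrite mxtraceZ mxtrace_conj_mx ?inG // card_cent1_in // fE_cent //.
by ring.
Qed.

Lemma tr_eJ_b J :
  \tr (eJ J *m rho b) = (#|A|%:R)^-1 * (#|'C_A[b]%g|%:R *+ 2 * \sum_(x in A) sg J x).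
Proof.
rewrite /eJ -scalemxAl mxtraceZ mulmx_suml raddf_sum /= -sum_sigmaV.
congr (_ * _); rewrite mulr_sumr; apply: eq_bigr => x Ax.
rewrite -scalemxAl mxtraceZ -conj_mxM ?(inG Ax) // mxtrace_conj_mx ?groupM ?(inG Ax) //.
by rewrite card_cent1_out // mulrC.
Qed.

(* [b ^ 2 = y] acts on the image of [eJ J] as [sigma J y], so for [c = 1, -1]
   the matrix [eL J c] projects onto the eigenspace of [b] for [c * root_y J].
   The principal square root makes [root_y J = 1] when [sigma J y = 1], so that
   [c = 1] is the trivial representation and not the sign. *)
Definition root_y J := sqrtC (sg J y).

Definition eL J (c : C) : 'M[C]_#|G| :=
  2^-1 *: (eJ J + (c / root_y J) *: (eJ J *m rho b)).

Let scaler_swap (c c' : C) (X : 'M[C]_#|G|) : c *: (c' *: X) = c' *: (c *: X).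
Proof. by rewrite !scalerA mulrC. Qed.

Section LinearIdempotent.
Variables (J : 'I_k -> nat).
Hypothesis fixJ : conj_tuple J =1 J.
Local Notation w := (root_y J).

Lemma eJ_b : rho b *m eJ J = eJ J *m rho b.
Proof.
rewrite rho_b_eJ (@eq_eJ _ J) // => x _.
by apply: eq_bigr => i _; rewrite fixJ.
Qed.

Lemma root_y2 : w * w = sg J y.
Proof. by rewrite -expr2 sqrtCK. Qed.

Lemma root_y_neq0 : w != 0.
Proof.
rewrite sqrtC_eq0; apply/eqP => y0; have := sigmaV J Ay.
by rewrite y0 mulr0 => /esym/eqP; rewrite oner_eq0.
Qed.

Lemma eJ_bb : eJ J *m rho b *m rho b = (w * w) *: eJ J.
Proof. by rewrite -mulmxA -conj_mxM // -expg2 b2 eJ_rho // root_y2. Qed.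

Lemma eL_b c : c * c = 1 -> eL J c *m rho b = (c * w) *: eL J c.
Proof.
move=> c1; rewrite /eL -(scalemxAl 2^-1) [RHS]scaler_swap mulmxDl.
rewrite -(scalemxAl (c / w)) eJ_bb.
congr (_ *: _); rewrite scalerDr !scalerA addrC.
have -> : c / w * (w * w) = c * w by field; apply: root_y_neq0.
have -> : c * w * (c / w) = 1 by rewrite mulrACA c1 mul1r mulfV ?root_y_neq0.
by rewrite scale1r.
Qed.

Lemma rho_b_eL c : rho b *m eL J c = eL J c *m rho b.
Proof.
rewrite /eL -(scalemxAl 2^-1) -(scalemxAr 2^-1) mulmxDl mulmxDr eJ_b.
by rewrite -(scalemxAl (c / w)) -(scalemxAr (c / w)) mulmxA eJ_b.
Qed.

Lemma eL_in c x : x \in A -> eL J c *m rho x = sg J x *: eL J c.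
Proof.
move=> Ax; rewrite /eL -(scalemxAl 2^-1) [RHS]scaler_swap mulmxDl -(scalemxAl (c / w)).
congr (_ *: _); rewrite [RHS]scalerDr; congr (_ + _); first exact: eJ_rho.
rewrite [RHS]scaler_swap; congr (_ *: _).
by rewrite -eJ_b -mulmxA eJ_rho // -(scalemxAr (sg J x)).
Qed.

Lemma rho_eL_in c x : x \in A -> rho x *m eL J c = eL J c *m rho x.
Proof.
move=> Ax; rewrite eL_in // /eL -(scalemxAr 2^-1) [RHS]scaler_swap mulmxDr.
rewrite -(scalemxAr (c / w)).
congr (_ *: _); rewrite [RHS]scalerDr; congr (_ + _); first exact: rho_eJ.
by rewrite [RHS]scaler_swap mulmxA rho_eJ // -(scalemxAl (sg J x)).
Qed.

Lemma rho_eL c g : g \in G -> rho g *m eL J c = eL J c *m rho g.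
Proof.
move=> Gg; have [Ag | nAg] := boolP (g \in A); first exact: rho_eL_in.
have Agb : (g * b^-1)%g \in A.
  by move: nAg; rewrite (index2_mem sAG iAG Gb nAb Gg) negbK.
rewrite -(mulgKV b g) conj_mxM ?(inG Agb) // -mulmxA rho_b_eL !mulmxA.
by rewrite rho_eL_in.
Qed.

Lemma eL_scal c g : c * c = 1 -> g \in G -> exists l, eL J c *m rho g = l *: eL J c.
Proof.
move=> c1 Gg; have [Ag | nAg] := boolP (g \in A).
  by exists (sg J g); apply: eL_in.
have Agb : (g * b^-1)%g \in A.
  by move: nAg; rewrite (index2_mem sAG iAG Gb nAb Gg) negbK.
exists (sg J (g * b^-1)%g * (c * w)).
rewrite -{1}(mulgKV b g) conj_mxM ?(inG Agb) // mulmxA eL_in //.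
by rewrite -(scalemxAl (sg J _)) eL_b // scalerA.
Qed.

Lemma eL_eJ c : eL J c *m eJ J = eL J c.
Proof.
rewrite /eL -(scalemxAl 2^-1) mulmxDl eJ_idem -(scalemxAl (c / w)).
by rewrite -mulmxA eJ_b mulmxA eJ_idem.
Qed.

Lemma eJ_eL c : eJ J *m eL J c = eL J c.
Proof.
rewrite /eL -(scalemxAr 2^-1) mulmxDr eJ_idem -(scalemxAr (c / w)).
by rewrite mulmxA eJ_idem.
Qed.

(** One formula for two uses: c' = c gives idempotence, c c' = -1 orthogonality. *)
Lemma eL_mul c c' : c * c = 1 ->
  eL J c *m eL J c' = ((1 + c * c') / 2) *: eL J c.
Proof.
move=> c1; rewrite {2}/eL -(scalemxAr 2^-1) mulmxDr eL_eJ -(scalemxAr (c' / w)).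
rewrite mulmxA eL_eJ eL_b // scalerA -[X in X + _]scale1r -scalerDl scalerA.
have -> : c' / w * (c * w) = c * c' by field; apply: root_y_neq0.
by rewrite mulrC.
Qed.

Lemma eL_idem c : c * c = 1 -> eL J c *m eL J c = eL J c.
Proof.
by move=> c1; rewrite eL_mul // c1 -[1 + 1]/(2%:R) divff ?scale1r ?pnatr_eq0.
Qed.

Lemma eL_sum : eL J 1 + eL J (-1) = eJ J.
Proof.
rewrite /eL -scalerDr addrACA mulNr scaleNr subrr addr0 -mulr2n -scaler_nat.
by rewrite scalerA mulVf ?scale1r // pnatr_eq0.
Qed.

Lemma tr_eL c : \tr (eL J c) = (\tr (eJ J) + c / w * \tr (eJ J *m rho b)) / 2.
Proof. by rewrite mxtraceZ mxtraceD mxtraceZ mulrC. Qed.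

End LinearIdempotent.

Lemma eq_sigma J J' x : J =1 J' -> sg J x = sg J' x.
Proof. by move=> JJ'; apply: eq_bigr => i _; rewrite JJ'. Qed.

Lemma sigma_neq J J' :
  (forall i, J i < q i)%N -> (forall i, J' i < q i)%N -> ~ (J =1 J') ->
  exists2 x, x \in A & sg J x != sg J' x.
Proof.
move=> Jq J'q JJ'; have [/existsP[x /andP[Ax nx]]|] :=
  boolP [exists x, (x \in A) && (sg J x != sg J' x)]; first by exists x.
rewrite negb_exists => /forallP allx; case: JJ'; apply: sigma_inj => // x Ax.
by have := allx x; rewrite Ax /= negbK => /eqP.
Qed.

Lemma conj_tupleK J : (forall i, J i < q i)%N -> conj_tuple (conj_tuple J) =1 J.
Proof.
move=> Jq; apply: sigma_inj => // [i|x Ax]; first exact: conj_tuple_lt.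
by rewrite -!sigma_f ?f_in // f_invol.
Qed.

Lemma eq_conj_tuple J J' : J =1 J' -> conj_tuple J =1 conj_tuple J'.
Proof. by move=> JJ' i; rewrite /conj_tuple JJ'. Qed.

Lemma admissibleP J : (forall i, J i < q i)%N ->
  admissible zeta A f a q J <-> ~ (conj_tuple J =1 J).
Proof.
move=> Jq; split=> [[_ [_ /imsetP[c Ac ->] nz]] fixJ | nfix].
  case/eqP: nz; rewrite sigmaM ?groupV ?f_in // sigma_f // (eq_sigma _ fixJ) mulrC.
  exact: sigmaV.
have [x Ax nx] := sigma_neq (@conj_tuple_lt J) Jq nfix.
split=> //; exists (f x * x^-1)%g; first exact: imset_f.
apply: contraNneq nx; rewrite sigmaM ?groupV ?f_in // sigma_f // => e.
by rewrite -[sg J x]mul1r -e -mulrA sigmaV // mulr1.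
Qed.

(** * The representations of G attached to the index tuples *)

Local Notation equiv2 := (rho2_equiv zeta G A f b y a q).
Local Notation R2 := (rho2 zeta A f b y a q).

Lemma rho2_equiv_eq J J' : {in A, sg J =1 sg J'} -> equiv2 J J'.
Proof.
move=> JJ'; exists 1%:M; rewrite ?unitmx1 // => g Gg; rewrite mulmx1 mul1mx.
have e2 x : x \in A -> rho2A zeta f a q J x = rho2A zeta f a q J' x.
  by move=> Ax; rewrite /rho2A !JJ' ?f_in.
rewrite /rho2 (index2_mem sAG iAG Gb nAb Gg); case: ifPn => [nA|]; last first.
  by rewrite negbK => Ag; rewrite e2 // /rho2b JJ'.
by rewrite e2 // (index2_mem sAG iAG Gb nAb Gg).
Qed.

(** The intertwiner is the matrix of b itself, which swaps the two diagonal entries; the matrices of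
    b agree for J and J' because f y = y. *)
Lemma rho2_equiv_conj J J' : {in A, forall x, sg J' x = sg J (f x)} -> equiv2 J J'.
Proof.
move=> JJ'; have y0 : sg J y != 0.
  by apply/eqP => y0; have /eqP := sigmaV J Ay; rewrite y0 mulr0 eq_sym oner_eq0.
exists (rho2b zeta y a q J).
  suff: rho2b zeta y a q J *m ((sg J y)^-1 *: rho2b zeta y a q J) = 1%:M.
    by case/mulmx1_unit.
  rewrite -scalemxAr /rho2b mulmx_block !(mulmx0, mul0mx, mulmx1, mul1mx, addr0, add0r).
  by rewrite scale_block_mx !scaler0 scale_scalar_mx mulVf // -scalar_mx_block.
have e2 x : x \in A -> rho2A zeta f a q J x *m rho2b zeta y a q J =
    rho2b zeta y a q J *m rho2A zeta f a q J' x.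
  move=> Ax; rewrite /rho2A /rho2b !mulmx_block.
  rewrite !(mulmx0, mul0mx, mulmx1, mul1mx, addr0, add0r).
  by rewrite !JJ' ?f_in // f_invol // -!scalar_mxM mulrC.
have eb : rho2b zeta y a q J' = rho2b zeta y a q J.
  by rewrite /rho2b JJ' // f_y.
move=> g Gg; rewrite /rho2; case: ifPn => [/e2 //|].
rewrite (index2_mem sAG iAG Gb nAb Gg) negbK => Ag.
by rewrite mulmxA -e2 // eb.
Qed.

(** Over A the first row of an intertwiner already decides: a nonzero entry in its first or second
    column gives the first or second alternative, and an invertible matrix has no zero row. *)
Lemma rho2_equivP J J' : equiv2 J J' ->
  {in A, sg J =1 sg J'} \/ {in A, forall x, sg J x = sg J' (f x)}.
Proof.
case=> P Pu PJ.
have eqA x : x \in A ->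
    sg J x *: ulsubmx P = sg J' x *: ulsubmx P /\
    sg J x *: ursubmx P = sg J' (f x) *: ursubmx P.
  move=> Ax; have := PJ x (inG Ax); rewrite /rho2 Ax /rho2A -{1 2}(submxK P).
  rewrite !mulmx_block !(mulmx0, mul0mx, addr0, add0r) !mul_scalar_mx !mul_mx_scalar.
  by case/eq_block_mx.
have [Pl0 | Pl0] := eqVneq (ulsubmx P) 0; last first.
  left=> x /eqA[/eqP + _]; rewrite -subr_eq0 -scalerBl scaler_eq0 (negPf Pl0) orbF.
  by rewrite subr_eq0 => /eqP.
have [Pr0 | Pr0] := eqVneq (ursubmx P) 0; last first.
  right=> x /eqA[_ /eqP]; rewrite -subr_eq0 -scalerBl scaler_eq0 (negPf Pr0) orbF.
  by rewrite subr_eq0 => /eqP.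
have : row_mx 1%:M 0 *m P = 0 :> 'M_(1, 1 + 1).
  rewrite -(submxK P) Pl0 Pr0 mul_row_block !(mulmx0, mul0mx, addr0).
  by rewrite row_mx0.
move/(congr1 (mulmx^~ (invmx P))); rewrite mulmxK // mul0mx -row_mx0.
case/eq_row_mx => /matrixP/(_ 0 0); rewrite !mxE eqxx => /eqP.
by rewrite oner_eq0.
Qed.

(** * Enumeration of the characters of A by the two index families *)

Local Notation D := (\prod_i d i)%N.
Variables (I : 'I_D -> 'I_k -> nat) (N : nat) (J : 'I_N -> 'I_k -> nat).
Hypothesis I_index : indexes_irr1 d I.
Hypothesis J_index : indexes_irr2 zeta G A f b y a q J.

(* The f-invariant characters of [A] are the [sigma (lin r)].  The value at
   [a_i] is the power [I r i] of the primitive [d i]-th root of unity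
   [zeta (q i) ^+ (q i %/ d i)], which may differ from [zeta (d i)]; the block
   sizes do not depend on this choice. *)
Definition lin r i := (q i %/ d i * I r i)%N.

Lemma lin_lt r i : (lin r i < q i)%N.
Proof.
rewrite -[X in (_ < X)%N](divnK (fix_ord_dvd i)) ltn_pmul2l ?quo_gt0 //.
by case: I_index.
Qed.

Lemma lin_fix r : conj_tuple (lin r) =1 lin r.
Proof. by apply/conj_tuple_fixP => i; rewrite ?lin_lt ?dvdn_mulr. Qed.

Lemma lin_inj r r' : lin r =1 lin r' -> r = r'.
Proof.
case: I_index => Id I_surj rr'; have [r0 [_ r0u]] := I_surj (I r) (Id r).
rewrite -(r0u r) //; apply: r0u => i; have /eqP := rr' i.
by rewrite eqn_pmul2l ?quo_gt0 // eq_sym => /eqP.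
Qed.

Lemma lin_surj t : (forall i, q i %/ d i %| t i)%N ->
  exists r, forall i, lin r i = t i %[mod q i].
Proof.
case: I_index => Id I_surj qt.
have [i|r [rt _]] := I_surj (fun i => (t i %% q i) %/ (q i %/ d i))%N.
  by rewrite ltn_divLR ?quo_gt0 // mulnC divnK ?fix_ord_dvd // ltn_mod q_gt0.
exists r => i; rewrite /lin rt mulnC divnK ?modn_mod // /dvdn.
by rewrite modn_dvdm ?dvdn_div ?fix_ord_dvd //; apply: qt.
Qed.

(** Exponents of fixed words and the tuples [lin r] satisfy the same divisibility, so the family
    indexing the linear characters also enumerates the fixed points of f. *)
Lemma card_fix : #|'C_A[b]%g| = D.
Proof.
rewrite -[RHS]card_ord -[RHS](card_imset (f := fun r => word (lin r))); last first.
  move=> r r' /word_eq e; apply: lin_inj => i.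
  by have := e i; rewrite !modn_small ?lin_lt.
apply: eq_card => x; apply/setIP/imsetP => [[Ax xb] | [r _ ->]].
  have fx : f (word (coords a x)) = word (coords a x).
    by rewrite coordsK //; apply/eqP; rewrite fE_cent.
  have [r e] := lin_surj (proj1 (f_fixP _) fx).
  by exists r => //; rewrite -[LHS](coordsK Ax); apply/esym/word_eq.
split; first exact: mem_word.
rewrite -fE_cent ?mem_word //; apply/eqP/f_fixP => i.
by rewrite dvdn_mulr.
Qed.

Lemma J_lt u i : (J u i < q i)%N.
Proof. by case: J_index => adm _ _; case: (adm u). Qed.

Lemma J_not_fix u : ~ (conj_tuple (J u) =1 J u).
Proof. by apply/admissibleP; [apply: J_lt | case: J_index]. Qed.

Lemma J_inj u v : J u =1 J v -> u = v.
Proof.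
case: J_index => _ J_uniq _ uv; apply: J_uniq; apply: rho2_equiv_eq => x _.
exact: eq_sigma.
Qed.

(** Conjugate tuples give equivalent representations, so the equality would force u = v and make
    [J v] invariant. *)
Lemma J_inj_conj u v : ~ (J u =1 conj_tuple (J v)).
Proof.
case: J_index => _ J_uniq _ uv.
have eq_uv : u = v.
  apply/esym/J_uniq/rho2_equiv_conj => x Ax.
  by rewrite sigma_f //; apply: eq_sigma.
by apply: (@J_not_fix v); rewrite -{2}eq_uv => i; rewrite uv.
Qed.

Lemma J_surj t : (forall i, t i < q i)%N -> ~ (conj_tuple t =1 t) ->
  exists u, t =1 J u \/ t =1 conj_tuple (J u).
Proof.
move=> tq /(admissibleP tq) adm; case: J_index => _ _ /(_ t adm) [u].
case/rho2_equivP => e; exists u.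
  by left; apply: sigma_inj => //; apply: J_lt.
right; apply: sigma_inj => // [i|x Ax]; first exact: conj_tuple_lt.
by rewrite e // sigma_f.
Qed.

(** The boolean selects one of the two characters in the restriction to A of the representation of
    [J u]. *)
Definition tuple_of (z : 'I_D + 'I_N * bool) : 'I_k -> nat :=
  match z with
  | inl r => lin r
  | inr (u, false) => J u
  | inr (u, true) => conj_tuple (J u)
  end.

Lemma tuple_of_lt (z : 'I_D + 'I_N * bool) i : (tuple_of z i < q i)%N.
Proof.
by case: z => [r|[u []]]; [apply: lin_lt | apply: conj_tuple_lt | apply: J_lt].
Qed.

Lemma tuple_of_inj (z z' : 'I_D + 'I_N * bool) : tuple_of z =1 tuple_of z' -> z = z'.
Proof.
have conj_not_fix u : ~ (conj_tuple (conj_tuple (J u)) =1 conj_tuple (J u)).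
  move=> fixJ; apply: (@J_not_fix u) => i.
  by rewrite -fixJ conj_tupleK //; apply: J_lt.
have fix_lin r t : lin r =1 t -> conj_tuple t =1 t.
  by move=> rt i; rewrite -rt -(eq_conj_tuple rt) lin_fix.
case: z z' => [r|[u c]] [r'|[u' c']] /= e.
- by rewrite (lin_inj e).
- by case: c' e => /fix_lin; [move/conj_not_fix | move/J_not_fix].
- by case: c e => /fsym/fix_lin; [move/conj_not_fix | move/J_not_fix].
case: c c' e => [] [] e; first last.
- by rewrite (J_inj e).
- by case/J_inj_conj: e.
- by case/fsym/J_inj_conj: e.
suff -> : u = u' by [].
apply: J_inj => i; rewrite -(conj_tupleK (@J_lt u)) -(conj_tupleK (@J_lt u')).
exact: eq_conj_tuple.
Qed.

Lemma tuple_of_surj t : (forall i, t i < q i)%N ->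
  exists z : 'I_D + 'I_N * bool, tuple_of z =1 t.
Proof.
move=> tq; have [fix_t | nfix_t] := boolP [forall i, conj_tuple t i == t i].
  have /conj_tuple_fixP-/(_ tq) : conj_tuple t =1 t.
    by move=> i; apply/eqP/(forallP fix_t).
  case/lin_surj => r rt; exists (inl r) => i.
  by have := rt i; rewrite !modn_small ?lin_lt.
have [|u [e|e]] := @J_surj t tq.
- by move=> fix_t; case/forallP: nfix_t => i; rewrite fix_t.
- by exists (inr (u, false)) => i; rewrite e.
by exists (inr (u, true)) => i; rewrite e.
Qed.

Lemma sum_eJ_tuple_of : \sum_(z : 'I_D + 'I_N * bool) eJ (tuple_of z) = 1%:M.
Proof.
(* The default of [insubd] is never reached: the entries are below q i <= #|gT|. *)
pose T (z : 'I_D + 'I_N * bool) :=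
  [ffun i => insubd (enum_rank (1%g : gT)) (tuple_of z i)].
have TE (z : 'I_D + 'I_N * bool) i : T z i = tuple_of z i :> nat.
  by rewrite ffunE val_insubd (leq_trans (tuple_of_lt z i) (q_leq i)).
have T_inj : injective T.
  by move=> z z' e; apply: tuple_of_inj => i; rewrite -!TE e.
have -> : \sum_(z : 'I_D + 'I_N * bool) eJ (tuple_of z) =
    \sum_(z : 'I_D + 'I_N * bool) eJ (fun i => T z i : nat).
  apply: eq_bigr => z _; apply: eq_eJ => x _; apply: eq_sigma => i.
  by rewrite TE.
pose F (t : {ffun 'I_k -> 'I_#|gT|}) := eJ (fun i => t i : nat).
rewrite -(big_imset F) /=; last by move=> z z' _ _; apply: T_inj.
rewrite -sum_eJ; apply: eq_bigl => t; apply/imsetP/tuplesP => [[z _ ->] i|tq].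
  by rewrite TE tuple_of_lt.
have [z zt] := tuple_of_surj tq; exists z => //.
by apply/ffunP => i; apply: val_inj; rewrite /= TE zt.
Qed.

Lemma sum_sigma_fix t : \sum_(x in 'C_A[b]%g) sg t x =
  if [forall i, d i %| t i]%N then D%:R else 0.
Proof.
rewrite sum_sigma_group ?subsetIl // card_fix; congr (if _ then _ else _).
apply/forall_inP/forallP => [t1 | /sigma_fixedP t1 x].
  apply/sigma_fixedP => x Ax fx; apply/eqP/t1.
  by rewrite in_setI Ax -fE_cent // fx eqxx.
by rewrite in_setI => /andP[Ax]; rewrite -fE_cent // => /eqP/t1->.
Qed.

Lemma sum_sigma_all t : (forall i, t i < q i)%N ->
  \sum_(x in A) sg t x = if [forall i, t i == 0%N] then #|A|%:R else 0.
Proof.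
move=> tq; rewrite sum_sigma_group //; congr (if _ then _ else _).
have sg0 x : sg (fun=> 0%N) x = 1.
  by rewrite /sigma big1 // => i _; rewrite mul0n expr0.
apply/forall_inP/forallP => [t1 i | t0 x Ax].
  apply/eqP; apply: (sigma_inj tq (J' := fun=> 0%N)) => [j|x Ax]; first exact: q_gt0.
  by rewrite sg0; apply/eqP/t1.
by rewrite (@eq_sigma _ (fun=> 0%N)) ?sg0 // => i; apply/eqP.
Qed.

(** * The idempotents of the blocks *)

Local Notation block := (block_dim q d #|A| D I J).

(** One of the two conjugate projections suffices for [J u]: the eigenspace of [sigma (J u)] meets
    each copy of the two-dimensional representation in a line, so its dimension is the
    multiplicity. *)
Definition block_idem (x : 'I_D + 'I_D + 'I_N) : 'M[C]_#|G| :=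
  match x with
  | inl (inl r) => eL (lin r) 1
  | inl (inr r) => eL (lin r) (-1)
  | inr u => eJ (J u)
  end.

Lemma block_idem_idem (x : 'I_D + 'I_D + 'I_N) :
  block_idem x *m block_idem x = block_idem x.
Proof.
case: x => [[r|r]|u] /=; last exact: eJ_idem.
  exact: eL_idem (@lin_fix r) _ (mulr1 1).
by apply: eL_idem; [apply: lin_fix | rewrite mulrNN mulr1].
Qed.

(** Since I r i < d i, divisibility by d i means I r i = 0, so the first case is the trivial
    character. Only there does b have nonzero trace, and the sign c matters. *)
Lemma rank_eL r (c : C) : c * c = 1 ->
  2 * (\rank (eL (lin r) c))%:R =
    if [forall i, d i %| I r i]%N then #|A|%:R + D%:R + c * (2 * D%:R)
    else if middle_case q d (I r) then D%:R else 0.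
Proof.
move=> c1; rewrite -mxtrace_idempotent; last exact: (eL_idem (@lin_fix r)).
rewrite tr_eL mulrCA divff ?pnatr_eq0 // mulr1 tr_eJ tr_eJ_b.
rewrite sum_sigma_fix (sum_sigma_all (@lin_lt r)) card_fix.
have -> : [forall i, lin r i == 0%N] = [forall i, d i %| I r i]%N.
  apply: eq_forallb => i; rewrite muln_eq0 (gtn_eqF (quo_gt0 i)) /=.
  apply/eqP/idP => [->|] //.
  case: I_index => Id _; have lt := Id r i.
  by rewrite /dvdn modn_small // => /eqP.
case: ifPn => [/forallP l0 | l1].
  have lin0 : lin r =1 fun=> 0%N.
    move=> i; apply/eqP; rewrite muln_eq0; apply/orP; right.
    by case: I_index => Id _; have := l0 i; rewrite /dvdn modn_small ?Id.
  have -> : root_y (lin r) = 1.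
    rewrite /root_y (eq_sigma _ lin0) /sigma.
    by rewrite big1 ?sqrtC1 // => i _; rewrite mul0n expr0.
  rewrite ifT; last by apply/forallP => i; rewrite lin0.
  by rewrite divr1; congr (_ + _ * _); rewrite mulrC mulfK // mulr_natl.
rewrite !mulr0 addr0 add0r /middle_case.
by move: l1; rewrite negb_forall => ->.
Qed.

Lemma rank_block_idem (x : 'I_D + 'I_D + 'I_N) : \rank (block_idem x) = block x.
Proof.
(* The halves are exact because each halved number is shown to be twice a rank. *)
have nat2 (m p : nat) : 2 * m%:R = p%:R :> C -> m = p./2.
  rewrite -natrM => /eqP; rewrite eqr_nat => /eqP <-.
  by rewrite mul2n doubleK.
case: x => [[r|r]|u] /=.
- have := @rank_eL r 1 (mulr1 1); rewrite /dim_I1; case: ifP => _.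
    by move=> e; apply: nat2; rewrite e natrD natrM; ring.
  by case: ifP => _ e; [apply: nat2 | apply: (nat2 _ 0%N)].
- have c1 : -1 * -1 = 1 :> C by rewrite mulrNN mulr1.
  have := @rank_eL r (-1) c1; rewrite /dim_I2; case: ifP => _; last first.
    by case: ifP => _ e; [apply: nat2 | apply: (nat2 _ 0%N)].
  (* Subtraction of naturals is truncated, so n is first written as twice the rank plus d. *)
  move=> e; have : (2 * \rank (eL (lin r) (-1)) + D)%N = #|A|.
    apply/eqP; rewrite -(eqr_nat C) natrD natrM e.
    by apply/eqP; ring.
  by move=> <-; rewrite addnK mul2n doubleK.
apply/eqP; rewrite -(eqr_nat C) -mxtrace_idempotent ?eJ_idem //.
rewrite tr_eJ sum_sigma_fix sum_sigma_all; last exact: J_lt.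
rewrite ifF; first by rewrite add0r /dim_J; case: ifP.
apply/negP => /forallP J0; apply: (@J_not_fix u) => i.
by rewrite /conj_tuple (eqP (J0 i)) mul0n mod0n.
Qed.

(** Conjugation by G fixes each [eL (lin r) c], giving |G| equal terms; for [J u] it yields the
    projection and its conjugate |A| times each. *)
Definition block_coef (x : 'I_D + 'I_D + 'I_N) : C :=
  if x is inl _ then (#|G|%:R)^-1 else (#|A|%:R)^-1.

Lemma sum_conj_block_idem :
  \sum_(x : 'I_D + 'I_D + 'I_N) block_coef x *:
    (\sum_(g in G) rho g *m block_idem x *m rho g^-1%g) = 1%:M.
Proof.
have rhoV g : g \in G -> rho g *m rho g^-1%g = 1%:M.
  by move=> Gg; rewrite -conj_mxM ?groupV // mulgV conj_mx1.
have G0 : #|G|%:R != 0 :> C by rewrite pnatr_eq0 -lt0n cardG_gt0.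
have linE r c : (#|G|%:R)^-1 *:
    (\sum_(g in G) rho g *m eL (lin r) c *m rho g^-1%g) = eL (lin r) c.
  rewrite (eq_bigr (fun=> eL (lin r) c)) => [|g Gg].
    by rewrite sumr_const -(scaler_nat _ (eL (lin r) c)) scalerA mulVf // scale1r.
  by rewrite (rho_eL (@lin_fix r)) // -mulmxA rhoV ?mulmx1.
have conj_in t x : x \in A -> rho x *m eJ t *m rho x^-1%g = eJ t.
  move=> Ax; rewrite rho_eJ // -eJ_rho // -mulmxA rhoV ?mulmx1 //; exact: inG.
have twoE u : (#|A|%:R)^-1 *:
    (\sum_(g in G) rho g *m eJ (J u) *m rho g^-1%g) =
    eJ (J u) + eJ (conj_tuple (J u)).
  rewrite big_index2 (eq_bigr (fun=> eJ (J u))); last by move=> x; apply: conj_in.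
  rewrite [X in _ + X](eq_bigr (fun=> eJ (conj_tuple (J u)))) => [|x Ax]; last first.
    have Gx := inG Ax; rewrite invMg !conj_mxM ?groupV // -(mulmxA (rho x)) rho_b_eJ.
    rewrite !mulmxA -(mulmxA _ (rho b)) rhoV // mulmx1.
    exact: conj_in.
  rewrite !sumr_const -(scaler_nat _ (eJ (J u))).
  rewrite -(scaler_nat _ (eJ (conj_tuple _))) scalerDr.
  by congr (_ + _); rewrite scalerA mulVf ?scale1r.
rewrite big_sumType big_sumType /= -sum_eJ_tuple_of big_sumType /=.
congr (_ + _).
  rewrite -big_split /=; apply: eq_bigr => r _.
  by rewrite !linE eL_sum //; apply: lin_fix.
under eq_bigr => u _ do rewrite twoE.
pose F u c := eJ (if c then conj_tuple (J u) else J u).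
rewrite [RHS](eq_bigr (fun w => F w.1 w.2)); last by case=> u [].
by rewrite -(pair_bigA _ F); apply: eq_bigr => u _; rewrite big_bool addrC.
Qed.

Lemma eL_ortho r c r' c' : r != r' -> eL (lin r) c *m eL (lin r') c' = 0.
Proof.
move=> rr'.
have [x Ax nx] := sigma_neq (@lin_lt r) (@lin_lt r')
  (fun e => negP rr' (introT eqP (lin_inj e))).
rewrite -(eL_eJ (@lin_fix r)) -(eJ_eL (lin r') c') mulmxA -(mulmxA (eL _ _)).
by rewrite (eJ_ortho Ax nx) mulmx0 mul0mx.
Qed.

Lemma lin_J_ortho r u : eJ (lin r) *m eJ (J u) = 0.
Proof.
have nlin : ~ (lin r =1 J u).
  by move=> e; apply: (@J_not_fix u) => i; rewrite -e -(eq_conj_tuple e) lin_fix.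
by have [x Ax nx] := sigma_neq (@lin_lt r) (@J_lt u) nlin; apply: eJ_ortho Ax nx.
Qed.

Lemma J_lin_ortho r u : eJ (J u) *m eJ (lin r) = 0.
Proof.
have nlin : ~ (J u =1 lin r).
  by move=> e; apply: (@J_not_fix u) => i; rewrite e (eq_conj_tuple e) lin_fix.
by have [x Ax nx] := sigma_neq (@J_lt u) (@lin_lt r) nlin; apply: eJ_ortho Ax nx.
Qed.

Lemma J_conj_ortho u v : eJ (J u) *m eJ (conj_tuple (J v)) = 0.
Proof.
have [x Ax nx] := sigma_neq (@J_lt u) (@conj_tuple_lt (J v)) (@J_inj_conj u v).
exact: eJ_ortho Ax nx.
Qed.

Lemma J_ortho u v : u != v -> eJ (J u) *m eJ (J v) = 0.
Proof.
move=> uv; have [x Ax nx] := sigma_neq (@J_lt u) (@J_lt v)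
  (fun e => negP uv (introT eqP (J_inj e))).
exact: eJ_ortho Ax nx.
Qed.

(* An element outside [A] moves the [sigma (J v)]-eigenspace to the conjugate one. *)
Lemma eJ_rho_eJ u v g : g \in G ->
  exists l, eJ (J u) *m rho g *m eJ (J v) = l *: (eJ (J u) *m eJ (J v)).
Proof.
move=> Gg; have [Ag | nAg] := boolP (g \in A).
  by exists (sg (J u) g); rewrite eJ_rho // -(scalemxAl (sg _ _)).
have Agb : (g * b^-1)%g \in A.
  by move: nAg; rewrite (index2_mem sAG iAG Gb nAb Gg) negbK.
exists 0; rewrite scale0r -(mulgKV b g) conj_mxM ?(inG Agb) // mulmxA eJ_rho //.
rewrite -mulmxA rho_b_eJ mulmxA -(scalemxAl (sg _ _)) J_conj_ortho.
by rewrite scaler0 mul0mx.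
Qed.

Lemma block_idem_ortho (x x' : 'I_D + 'I_D + 'I_N) g : x != x' -> g \in G ->
  block_idem x *m rho g *m block_idem x' = 0.
Proof.
move=> xx' Gg.
have eL0 r c X : c * c = 1 -> eL (lin r) c *m X = 0 ->
    eL (lin r) c *m rho g *m X = 0.
  move=> c1 X0; have [l ->] := eL_scal (@lin_fix r) c1 Gg.
  by rewrite -(scalemxAl l) X0 scaler0.
have eLJ r c u : eL (lin r) c *m eJ (J u) = 0.
  by rewrite -(eL_eJ (@lin_fix r)) -mulmxA lin_J_ortho mulmx0.
have eJL r c u : eJ (J u) *m eL (lin r) c = 0.
  by rewrite -(eJ_eL (lin r)) mulmxA J_lin_ortho mul0mx.
have c1 : -1 * -1 = 1 :> C by rewrite mulrNN mulr1.
have pm r r' c c' : c * c = 1 -> c * c' = -1 -> eL (lin r) c *m eL (lin r') c' = 0.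
  move=> cc cc'; have [<-|] := eqVneq r r'; last exact: eL_ortho.
  by rewrite (eL_mul (@lin_fix r)) // cc' subrr mul0r scale0r.
case: x x' xx' => [[r|r]|u] [[r'|r']|u'] /= xx'.
- by apply: eL0; rewrite ?mulr1 //; apply: eL_ortho; apply: contraNneq xx' => ->.
- by apply: eL0; rewrite ?mulr1 //; apply: pm; rewrite ?mulr1 ?mul1r.
- by apply: eL0; rewrite ?mulr1.
- by apply: eL0; rewrite // pm ?mulr1.
- by apply: eL0; rewrite // eL_ortho //; apply: contraNneq xx' => ->.
- by apply: eL0.
- by rewrite -mulmxA (rho_eL (@lin_fix r')) // mulmxA eJL mul0mx.
- by rewrite -mulmxA (rho_eL (@lin_fix r')) // mulmxA eJL mul0mx.
have uu' : u != u' by apply: contraNneq xx' => ->.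
by have [l ->] := eJ_rho_eJ u u' Gg; rewrite J_ortho ?scaler0.
Qed.

Lemma block_idem_scal (x : 'I_D + 'I_D + 'I_N) g : g \in G ->
  exists l, block_idem x *m rho g *m block_idem x = l *: block_idem x.
Proof.
move=> Gg; have eL_scal2 r c : c * c = 1 ->
    exists l, eL (lin r) c *m rho g *m eL (lin r) c = l *: eL (lin r) c.
  move=> c1; have [l ->] := eL_scal (@lin_fix r) c1 Gg.
  by exists l; rewrite -(scalemxAl l) (eL_idem (@lin_fix r)).
case: x => [[r|r]|u] /=.
- by apply: eL_scal2; rewrite mulr1.
- by apply: eL_scal2; rewrite mulrNN mulr1.
by have [l ->] := eJ_rho_eJ u u Gg; exists l; rewrite eJ_idem.
Qed.

Lemma block_idem_comm (x : 'I_D + 'I_D + 'I_N) X :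
  commutant G rho X -> X *m block_idem x = block_idem x *m X.
Proof.
move=> comX; have comL r c : X *m eL (lin r) c = eL (lin r) c *m X.
  have comXb : X *m (eJ (lin r) *m rho b) = eJ (lin r) *m rho b *m X.
    by rewrite mulmxA eJ_comm // -[LHS]mulmxA comX // mulmxA.
  rewrite /eL -(scalemxAl 2^-1) -(scalemxAr 2^-1) mulmxDl mulmxDr eJ_comm //.
  by rewrite -(scalemxAl (c / _)) -(scalemxAr (c / _)) comXb.
by case: x => [[r|r]|u] //=; apply: eJ_comm.
Qed.

Lemma commutant_block_sum :
  isog_matrix_sum (commutant G rho) (block_dim q d #|A| D I J).
Proof.
apply: (commutant_isog (E := block_idem) (c := block_coef)).
- exact: conj_mxM.
- exact: conj_mx1.
- exact: block_idem_comm.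
- exact: block_idem_idem.
- exact: rank_block_idem.
- exact: block_idem_ortho.
- exact: block_idem_scal.
exact: sum_conj_block_idem.
Qed.

End Characters.

Theorem theorem4p1 (R : realType) (zeta : nat -> R[i])
  (zeta_prim : forall m, (0 < m)%N -> m.-primitive_root (zeta m))
  (gT : finGroupType) (G A : {group gT}) (f : {perm gT}) (b y : gT)
  (G_nonabelian : ~~ abelian G) (A_abelian : abelian A)
  (A_sub : A \subset G) (A_index : #|G : A|%g = 2%N)
  (A_card : (3 <= #|A|)%N)
  (f_aut : f \in Aut A) (f_order : #[f]%g = 2%N)
  (y_in : y \in A) (f_y : f y = y)
  (G_pres : presents_ext2 G A f b y)
  (lam mu : nat) (lammu : (lam + mu != 0)%N)
  (a : 'I_(lam + mu) -> gT) (p e : 'I_(lam + mu) -> nat)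
  (p_prime : forall i, prime (p i))
  (p_two : forall i, (p i == 2%N) = (i < lam)%N)
  (a_order : forall i, #[a i]%g = (p i ^ e i)%N)
  (A_dprod : \big[dprod/1%g]_i <[a i]>%g = A)
  (s : 'I_(lam + mu) -> int)
  (f_diag : forall i x, x \in <[a i]>%g -> f x = zexpg x (s i)) :
  let n := #|A| in
  let q := fun i => (p i ^ e i)%N in
  let di := fix_ord q s in
  let d := (\prod_i di i)%N in
  forall (I : 'I_d -> 'I_(lam + mu) -> nat)
    (J : 'I_((n - d)./2) -> 'I_(lam + mu) -> nat),
  indexes_irr1 di I ->
  indexes_irr2 zeta G A f b y a q J ->
  isog_matrix_sum (terwilliger R[i] G) (block_dim q di n d I J).
Proof.
move=> n q di d I J I_index J_index; have [GbA b2 fE _] := G_pres.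
have Gb : b \in G by rewrite GbA mem_gen // setU11.
have nAb : b \notin A.
  apply: contraL isT => Ab; have sGA : G \subset A.
    by rewrite GbA gen_subG subUset sub1set Ab subxx.
  by have := A_index; rewrite (eqP (_ : #|G : A|%g == 1%N)) // indexg_eq1.
apply: (@eq_isog_matrix_sum _ _ _ (commutant G (conj_mx R[i] G))).
  move=> X; split; first exact: terwilliger_commutant.
  by apply: commutant_terwilliger => x z x1 z1; apply: (index2_orbit3 A_abelian).
exact: (commutant_block_sum zeta_prim A_abelian a_order A_dprod f_aut f_diag
  A_sub A_index Gb nAb y_in b2 fE I_index J_index).
Qed.
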